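(* With the complexes $\Pi(I)$, the partial compositions $\circ_i$ and the unit $1\in\Pi(\{1\})$ described in the context, $\Pi$ is a (symmetric) differential graded operad, i.e. an operad in the symmetric monoidal category of complexes of $\mathbb{Z}$-modules.
   Context: Operads are viewed as functors on the groupoid of finite non-empty sets (and bijections), with partial compositions $\circ_i:\mathcal P(I)\otimes \mathcal P(J)\to \mathcal P((I\setminus\{i\})\sqcup J)$ for $i\in I$. The ambient category is that of complexes of $\mathbb{Z}$-modules, with the usual Koszul sign in the symmetry. Definition of $\Pi$. For a finite non-empty set $I$, $\Pi(I)$ is the free $\mathbb{Z}$-module generated by expressions $\pi=\pi_1\otimes\pi_2\otimes\dots\otimes\pi_p$, where $\pi_j=i_{j,1}\wedge\dots\wedge i_{j,p_j}$ ($p_j\ge 1$, $i_{j,k}\in I$), every element of $I$ appearing in exactly one $\pi_j$ and exactly once, modulo the antisymmetry relations of the exterior products. (Up to sign the generators are the ordered partitions of $I$.) Bijections act by relabelling. Set $\dim(\pi_j)=p_j-1$ and $\dim(\pi)=\sum_j\dim(\pi_j)$; this is the grading. The differential, of degree $+1$, is $$d(\pi)=\sum_{j=1}^{p-1}(-1)^{\dim(\pi_1)+\dots+\dim(\pi_j)}\,\pi_1\otimes\dots\otimes \pi_j\wedge\pi_{j+1}\otimes\dots\otimes\pi_p .$$ Composition. Let $\pi=\pi_1\otimes\dots\otimes\pi_p\in\Pi(I)$, $\mu=\mu_1\otimes\dots\otimes\mu_q\in\Pi(J)$, $i\in I$, and let $\ell$ be the unique index such that $i$ appears in $\pi_\ell$.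 Up to a sign one may write $\pi_\ell=\pi'_\ell\wedge i$ (if $\pi_\ell=i$, the convention is $\pi'_\ell\wedge\nu=\nu$ for all $\nu$). Then $$\pi\circ_i\mu=\sum_\sigma\varepsilon(\sigma)\,\pi_1\otimes\dots\otimes\pi_{\ell-1}\otimes\pi'_\ell\wedge\mu_1\otimes\sigma(\pi_{\ell+1}\otimes\dots\otimes\pi_p\,,\,\mu_2\otimes\dots\otimes\mu_q),$$ where $\sigma$ runs over the shuffles of the sequence $\pi_{\ell+1},\dots,\pi_p$ with the sequence $\mu_2,\dots,\mu_q$, $\sigma(\cdots)$ is the tensor product of these blocks in the order specified by $\sigma$, and $\varepsilon(\sigma)$ is the Koszul sign (for the grading by $\dim$) for passing from $\pi_{\ell+1}\otimes\dots\otimes\pi_p\otimes\mu_1\otimes\dots\otimes\mu_q$ to $\mu_1\otimes\sigma(\pi_{\ell+1}\otimes\dots\otimes\pi_p,\mu_2\otimes\dots\otimes\mu_q)$. *)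

(* Defs.v *)
From HB Require Import structures.
From mathcomp Require Import all_boot all_order all_algebra.
From mathcomp Require Import generic_quotient ring_quotient.
From mathcomp Require Import boolp freeg.

Set Implicit Arguments.
Unset Strict Implicit.
Unset Printing Implicit Defensive.

Import GRing.Theory.
Local Open Scope ring_scope.
Local Open Scope quotient_scope.

Record nefin := NeFin { nf_car :> finType; nf_ne : (0 < #|nf_car|)%N }.

Record bij (I J : nefin) := Bij { bij_fun :> I -> J; bij_bij : bijective bij_fun }.

Lemma inj_surj_bij (S T : finType) (f : S -> T) :
  injective f -> (forall y, exists x, f x = y) -> bijective f.
Proof.
move=> fI fS; apply: inj_card_bij => //.
have -> : #|T| = #|[set f x | x : S]|.
  rewrite -cardsT; apply: eq_card => y; rewrite in_setT; apply/esym/imsetP.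
  by have [x <-] := fS y; exists x.
exact: leq_imset_card.
Qed.

Lemma id_bijective (T : Type) : bijective (@id T).
Proof. by exists id. Qed.

Definition bij_id (I : nefin) : bij I I := Bij (@id_bijective I).

Definition bij_comp (I J K : nefin) (g : bij J K) (f : bij I J) : bij I K :=
  Bij (bij_comp (bij_bij g) (bij_bij f)).

Lemma unit_ne : (0 < #|{: unit}|)%N.
Proof. by rewrite card_unit. Qed.

Definition pt : nefin := NeFin unit_ne.

(* I \ {i} *)
Notation del i := {x | x != i}.

Lemma ins_ne (I : finType) (i : I) (J : nefin) : (0 < #|{: del i + J}|)%N.
Proof. by rewrite card_sum addn_gt0 nf_ne orbT. Qed.

(* (I \ {i}) |_| J *)
Definition ins (I : nefin) (i : I) (J : nefin) : nefin := NeFin (ins_ne i J).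

Section CanonicalBijections.
Variables I J K : nefin.

Lemma bij_neq (I' : nefin) (f : bij I I') (i : I) (x : del i) : f (val x) != f i.
Proof. by rewrite (inj_eq (bij_inj (bij_bij f))) (valP x). Qed.

Definition ins_map_fun (I' J' : nefin) (f : bij I I') (g : bij J J') (i : I)
    (z : ins i J) : ins (f i) J' :=
  match z with
  | inl x => inl (exist _ (f (val x)) (bij_neq f x))
  | inr y => inr (g y)
  end.

Lemma ins_map_bij (I' J' : nefin) (f : bij I I') (g : bij J J') (i : I) :
  bijective (ins_map_fun f g (i := i)).
Proof.
have fI := bij_inj (bij_bij f); have gI := bij_inj (bij_bij g).
apply: inj_surj_bij => [[x|y] [x'|y'] //= [] |].
- by move=> /fI /val_inj ->.
- by move=> /gI ->.
case=> [[x xP]|y].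
  have [h _ hK] := bij_bij f.
  have hP : h x != i by apply: contraNneq xP => <-; rewrite hK.
  by exists (inl (exist _ (h x) hP)); congr inl; apply: val_inj; rewrite /= hK.
by have [h _ hK] := bij_bij g; exists (inr (h y)); rewrite /= hK.
Qed.

(* (I \ {i}) |_| J  -->  (I' \ {f i}) |_| J' *)
Definition ins_map (I' J' : nefin) (f : bij I I') (g : bij J J') (i : I) :
  bij (ins i J) (ins (f i) J') := Bij (ins_map_bij f g i).

Definition assoc_fun (i : I) (j : J) (z : ins i (ins j K)) :
    ins (inr j : ins i J) K :=
  match z with
  | inl x => inl (exist _ (inl x) isT)
  | inr (inl y) => inl (exist _ (inr (val y)) (valP y))
  | inr (inr k) => inr k
  end.

Lemma assoc_bij (i : I) (j : J) : bijective (assoc_fun (i := i) (j := j)).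
Proof.
apply: inj_surj_bij => [[x|[y|k]] [x'|[y'|k']] //= []|].
- by move=> ->.
- by move=> /val_inj ->.
- by move=> ->.
case=> [[[x|y] zP]|k].
- by exists (inl x); congr inl; apply: val_inj.
- by exists (inr (inl (exist _ y zP))); congr inl; apply: val_inj.
- by exists (inr (inr k)).
Qed.

(* (I \ {i}) |_| ((J \ {j}) |_| K)  -->  (((I \ {i}) |_| J) \ {j}) |_| K *)
Definition assoc (i : I) (j : J) : bij (ins i (ins j K)) (ins (inr j : ins i J) K) :=
  Bij (assoc_bij i j).

Section Parallel.
Variables (i k : I) (ki : k != i) (ik : i != k).

Definition del_k : ins i J := inl (exist _ k ki).
Definition del_i : ins k K := inl (exist _ i ik).

Definition par_fun (z : ins del_k K) : ins del_i J :=
  match z with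
  | inl s =>
    match val s as t return (t != del_k -> ins del_i J) with
    | inl x => fun xk => inl (exist _ (inl (exist _ (val x) xk)) (valP x))
    | inr y => fun _ => inr y
    end (valP s)
  | inr c => inl (exist _ (inr c) isT)
  end.

Lemma par_bij : bijective par_fun.
Proof.
apply: inj_surj_bij => [[[[x|y] sP]|c] [[[x'|y'] sP']|c'] //= []|].
- by move=> /val_inj xx'; subst x'; congr inl; apply: val_inj.
- by move=> yy'; subst y'; congr inl; apply: val_inj.
- by move=> ->.
case=> [[[[x xk]|c] sP]|y].
- have xi : x != i by [].
  have sk : (inl (exist _ x xi) : ins i J) != del_k by [].
  exists (inl (exist _ (inl (exist _ x xi)) sk)).
  by congr inl; apply: val_inj; congr inl; apply: val_inj.
- by exists (inr c); congr inl; apply: val_inj.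
- have sk : (inr y : ins i J) != del_k by [].
  by exists (inl (exist _ (inr y) sk)).
Qed.

(* (((I \ {i}) |_| J) \ {k}) |_| K  -->  (((I \ {k}) |_| K) \ {i}) |_| J *)
Definition par : bij (ins del_k K) (ins del_i J) := Bij par_bij.
End Parallel.

Definition runit_fun (i : I) (z : ins i pt) : I :=
  match z with inl x => val x | inr _ => i end.

Lemma runit_bij (i : I) : bijective (runit_fun (i := i)).
Proof.
apply: inj_surj_bij => [[x|[]] [x'|[]] //= |y].
- by move=> /val_inj ->.
- by move=> xi; have := valP x; rewrite /= xi eqxx.
- by move=> xi; have := valP x'; rewrite /= -xi eqxx.
have [->|yi] := eqVneq y i; first by exists (inr tt).
by exists (inl (exist _ y yi)).
Qed.

(* (I \ {i}) |_| {1}  -->  I,  1 |-> i *)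
Definition runit (i : I) : bij (ins i pt) I := Bij (runit_bij i).

Lemma del_pt (x : del (tt : pt)) : False.
Proof. by case: x => -[]. Qed.

Definition lunit_fun (z : ins (tt : pt) J) : J :=
  match z with inl x => False_rect _ (del_pt x) | inr y => y end.

Lemma lunit_bij : bijective lunit_fun.
Proof.
apply: inj_surj_bij => [[x|y] [x'|y'] //=|y]; try by case: (del_pt x).
- by case: (del_pt x').
- by move=> ->.
- by exists (inr y).
Qed.

(* ({1} \ {1}) |_| J  -->  J *)
Definition lunit : bij (ins (tt : pt) J) J := Bij lunit_bij.
End CanonicalBijections.

(* A complex of Z-modules is encoded as the direct sum of its components,     *)
(* together with the predicates defining the components.                      *)

Record cxdata := CxData {
  cx_mod :> zmodType;
  cx_gr : int -> cx_mod -> Prop; (* [cx_gr n x]: x is homogeneous of degree n *)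
  cx_d : cx_mod -> cx_mod
}.

Record is_complex (C : cxdata) : Prop := IsComplex {
  cx_gr0 : forall n, cx_gr n (0 : C);
  cx_grB : forall n (x y : C), cx_gr n x -> cx_gr n y -> cx_gr n (x - y);
  cx_gr_span : forall x : C, exists (s : seq int) (c : int -> C),
    (forall n, cx_gr n (c n)) /\ x = \sum_(n <- s) c n;
  cx_gr_indep : forall (s : seq int) (c : int -> C),
    uniq s -> (forall n, cx_gr n (c n)) -> \sum_(n <- s) c n = 0 ->
    forall n, n \in s -> c n = 0;
  cx_dD : forall x y : C, cx_d (x + y) = cx_d x + cx_d y;
  cx_d_gr : forall n (x : C), cx_gr n x -> cx_gr (n + 1) (cx_d x);
  cx_dd : forall x : C, cx_d (cx_d x) = 0
}.

Record is_chain_map (C D : cxdata) (f : C -> D) : Prop := IsChainMap {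
  cm_D : forall x y, f (x + y) = f x + f y;
  cm_gr : forall n x, cx_gr n x -> cx_gr n (f x);
  cm_d : forall x, f (cx_d x) = cx_d (f x)
}.

(* Morphisms of complexes A (x) B -> C, given by the bilinear map (a, b) |->
   f (a (x) b); recall that d (a (x) b) = da (x) b + (-1)^|a| a (x) db. *)
Record is_tensor_map (A B C : cxdata) (f : A -> B -> C) : Prop := IsTensorMap {
  tm_Dl : forall x x' y, f (x + x') y = f x y + f x' y;
  tm_Dr : forall x y y', f x (y + y') = f x y + f x y';
  tm_gr : forall m n x y, cx_gr m x -> cx_gr n y -> cx_gr (m + n) (f x y);
  tm_d : forall m x y, cx_gr m x ->
    cx_d (f x y) = f (cx_d x) y + f x (cx_d y) *~ ((-1) ^ m)
}.

(* Structures of symmetric dg operad on a given family P of complexes.        *)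

Record dg_operad (P : nefin -> cxdata) : Type := DgOperad {
  op_act : forall I J : nefin, bij I J -> P I -> P J;
  op_one : P pt;
  op_comp : forall (I : nefin) (i : I) (J : nefin), P I -> P J -> P (ins i J);

  op_complex : forall I, is_complex (P I);

  op_act_chain : forall (I J : nefin) (f : bij I J), is_chain_map (op_act f);
  op_act_ext : forall (I J : nefin) (f g : bij I J), f =1 g -> op_act f =1 op_act g;
  op_act_id : forall (I : nefin) (x : P I), op_act (bij_id I) x = x;
  op_act_comp : forall (I J K : nefin) (g : bij J K) (f : bij I J) (x : P I),
    op_act (bij_comp g f) x = op_act g (op_act f x);

  op_comp_tensor : forall (I : nefin) (i : I) (J : nefin),
    is_tensor_map (op_comp i (J := J));
  op_comp_act : forall (I I' J J' : nefin) (f : bij I I') (g : bij J J') (i : I)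
      (x : P I) (y : P J),
    op_comp (f i) (op_act f x) (op_act g y) = op_act (ins_map f g i) (op_comp i x y);

  op_one_gr : cx_gr 0 op_one;
  op_one_d : cx_d op_one = 0;
  op_compx1 : forall (I : nefin) (i : I) (x : P I),
    op_act (runit i) (op_comp i x op_one) = x;
  op_comp1x : forall (J : nefin) (y : P J),
    op_act (lunit J) (op_comp (tt : pt) op_one y) = y;

  op_comp_seq : forall (I J K : nefin) (i : I) (j : J) (x : P I) (y : P J) (z : P K),
    op_comp (inr j : ins i J) (op_comp i x y) z
    = op_act (assoc K i j) (op_comp i x (op_comp j y z));
  op_comp_par : forall (I J K : nefin) (i k : I) (ki : k != i) (ik : i != k)
      (m n : int) (x : P I) (y : P J) (z : P K),
    cx_gr m y -> cx_gr n z ->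
    op_act (par J K ki ik) (op_comp (del_k J ki) (op_comp i x y) z)
    = op_comp (del_i K ik) (op_comp k x z) y *~ ((-1) ^ (m * n))
}.

(* The expression pi_1 (x) ... (x) pi_p, where             *)
(* pi_j = i_{j,1} /\ ... /\ i_{j,p_j}, is the sequence of the sequences of    *)
(* the i_{j,k}.                                                               *)

Definition is_expr (I : finType) (w : seq (seq I)) :=
  ([::] \notin w) && perm_eq (flatten w) (enum I).

Record expr (I : finType) := Expr { expr_seq :> seq (seq I); _ : is_expr expr_seq }.

HB.instance Definition _ (I : finType) := [isSub for @expr_seq I].
HB.instance Definition _ (I : finType) := [Choice of expr I by <:].

Definition dim (T : Type) (b : seq T) : nat := (size b).-1.

Definition dims (T : Type) (w : seq (seq T)) : nat := (\sum_(b <- w) dim b)%N.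

Section Pi.
Variable I : finType.

(* Span of the relations u /\ x /\ y /\ v = - u /\ y /\ x /\ v, in any block.   *)
Inductive antisym : {freeg (expr I) / int} -> Prop :=
| Antisym0 : antisym 0
| AntisymB r s : antisym r -> antisym s -> antisym (r - s)
| AntisymSwap (e e' : expr I) A u x y v B :
    expr_seq e = A ++ (u ++ x :: y :: v) :: B ->
    expr_seq e' = A ++ (u ++ y :: x :: v) :: B ->
    antisym (<< e >> + << e' >>).

Definition antisym_pred : {pred {freeg (expr I) / int}} := fun r => `[< antisym r >].

Lemma antisym_zmod_closed : zmod_closed antisym_pred.
Proof.
split=> [|r s /asboolP rP /asboolP sP]; apply/asboolP.
  exact: Antisym0.
exact: AntisymB.
Qed.

HB.instance Definition _ :=
  GRing.isZmodClosed.Build {freeg (expr I) / int} antisym_pred antisym_zmod_closed.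

Definition Pi : zmodType := Quotient.quot antisym_pred.

Definition cls (r : {freeg (expr I) / int}) : Pi := \pi_(Quotient.quot antisym_pred) r.

(* The value on a sequence which is not an expression is irrelevant: by the
   lemmas is_expr_* below, this case does not occur in the formulas for the
   structure maps. *)
Definition gen (w : seq (seq I)) : Pi :=
  cls (oapp (fun e : expr I => << e >>) 0 (insub w)).

Definition Pi_gr (n : int) (x : Pi) : Prop :=
  exists2 r : {freeg (expr I) / int},
    (forall e, e \in dom r -> (dims e)%:Z = n) & x = cls r.

(* pi_1 (x) ... (x) pi_j /\ pi_(j+1) (x) ... (x) pi_p, for w = [pi_1; ...; pi_p] *)
Definition merge_at (w : seq (seq I)) (j : nat) : seq (seq I) :=
  take j.-1 w ++ (nth [::] w j.-1 ++ nth [::] w j) :: drop j.+1 w.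

Definition d_formula (w : seq (seq I)) : Pi :=
  \sum_(1 <= j < size w) gen (merge_at w j) *~ ((-1) ^+ dims (take j w)).
End Pi.

(* A shuffle of s with t is encoded by c : seq bool, of size size s + size t  *)
(* and with size s terms equal to true; the n-th term of c tells whether the  *)
(* n-th block of the result is taken from s.                                  *)

Fixpoint weave (T : Type) (c : seq bool) (s t : seq T) : seq T :=
  match c, s, t with
  | true :: c', b :: s', _ => b :: weave c' s' t
  | false :: c', _, b :: t' => b :: weave c' s t'
  | _, _, _ => [::]
  end.

(* Exponent of the Koszul sign for passing from s (x) t to weave c s t: a block
   b of t which is selected moves across all the remaining blocks of s. *)
Fixpoint koszul (T : Type) (c : seq bool) (s t : seq (seq T)) : nat :=
  match c, s, t with
  | true :: c', _ :: s', _ => koszul c' s' t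
  | false :: c', _, b :: t' => (dim b * dims s + koszul c' s t')%N
  | _, _, _ => 0%N
  end.

Section Comp.
Variables (I : nefin) (i : I) (J : nefin).
Let inI (w : seq (seq (del i))) : seq (seq (ins i J)) := map (map inl) w.
Let inJ (w : seq (seq J)) : seq (seq (ins i J)) := map (map inr) w.

(* A (x) (u /\ i) (x) B, where i does not appear in A, u, B *)
Definition comp_left (A : seq (seq (del i))) (u : seq (del i))
    (B : seq (seq (del i))) : seq (seq I) :=
  map (map val) A ++ rcons (map val u) i :: map (map val) B.

(* A (x) (u /\ m1) (x) c(B, ms) *)
Definition comp_term A (u : seq (del i)) B (m1 : seq J) (ms : seq (seq J)) (c : seq bool) :
    seq (seq (ins i J)) :=
  inI A ++ (map inl u ++ map inr m1) :: weave c (inI B) (inJ ms).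

(* The sign is the one for passing from B (x) m1 (x) ms to m1 (x) c(B, ms), which
   is the shuffle (false :: c) of B with m1 (x) ms. *)
Definition comp_formula A (u : seq (del i)) B (m1 : seq J) (ms : seq (seq J)) :
    Pi (ins i J) :=
  \sum_(c : (size B + size ms).-tuple bool | count id c == size B)
    gen (comp_term A u B m1 ms c) *~ ((-1) ^+ koszul (false :: c) (inI B) (inJ (m1 :: ms))).
End Comp.

Lemma is_exprP (I : finType) (w : seq (seq I)) :
  reflect [/\ [::] \notin w, uniq (flatten w) & forall x, x \in flatten w] (is_expr w).
Proof.
apply: (iffP andP) => [[w0 pw]|[w0 uw mw]]; split=> //.
- by rewrite (perm_uniq pw) enum_uniq.
- by move=> x; rewrite (perm_mem pw) mem_enum.
- by apply: uniq_perm => // [|x]; rewrite ?enum_uniq // mw mem_enum.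
Qed.

Lemma nil_map (S T : eqType) (f : S -> T) (w : seq (seq S)) :
  ([::] \in map (map f) w) = ([::] \in w).
Proof. by elim: w => //= -[|x b] w IHw; rewrite !in_cons IHw. Qed.

Lemma is_expr_relabel (I J : nefin) (f : bij I J) (w : seq (seq I)) :
  is_expr w -> is_expr (map (map f) w).
Proof.
move=> /is_exprP[w0 uw mw]; apply/is_exprP; have [h fK hK] := bij_bij f.
rewrite nil_map -map_flatten (map_inj_uniq (can_inj fK)); split=> // y.
by rewrite -(hK y) map_f.
Qed.

Lemma is_expr_pt : is_expr [:: [:: tt]].
Proof. by apply/is_exprP; split=> // -[]. Qed.

Lemma is_expr_merge (I : finType) (w : seq (seq I)) (j : nat) :
  is_expr w -> (0 < j < size w)%N -> is_expr (merge_at w j).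
Proof.
case: j => // j /is_exprP[w0 uw mw] /= jw; apply/is_exprP.
have jw' : (j < size w)%N by apply: ltnW.
have Ew : w = take j w ++ nth [::] w j :: nth [::] w j.+1 :: drop j.+2 w.
  by rewrite -(drop_nth _ jw) -(drop_nth _ jw') cat_take_drop.
have -> : flatten (merge_at w j.+1) = flatten w.
  by rewrite [in RHS]Ew /merge_at !flatten_cat /= !catA.
split=> //; move: w0; apply: contra; rewrite /merge_at /= => H.
rewrite Ew; move: H; rewrite !mem_cat !in_cons.
case/or3P=> [->|/eqP E|->]; rewrite ?orbT //.
by case: (nth [::] w j) E => // _; rewrite eqxx orbT.
Qed.

Lemma perm_weave (T : eqType) (c : seq bool) (s t : seq T) :
  size c = (size s + size t)%N -> count id c = size s ->
  perm_eq (weave c s t) (s ++ t).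
Proof.
elim: c s t => [|[] c IHc] [|b s] [|b' t] //=.
- by rewrite addSn => -[sc]; rewrite add1n => -[cc]; rewrite perm_cons IHc.
- by rewrite addSn => -[sc]; rewrite add1n => -[cc]; rewrite perm_cons IHc.
- by move=> [sc]; rewrite add0n => cc; rewrite perm_cons; apply: (IHc [::]).
- rewrite addn0 => -[sc]; rewrite add0n => cc.
  by have := count_size id c; rewrite sc cc ltnn.
- rewrite addnS => -[sc]; rewrite add0n => cc.
  have -> : b :: s ++ b' :: t = (b :: s) ++ [:: b'] ++ t by [].
  by rewrite perm_sym perm_catCA /= perm_cons perm_sym; apply: (IHc (b :: s)).
Qed.

Lemma is_expr_comp (I : nefin) (i : I) (J : nefin) A u B (m1 : seq J) ms
    (c : (size B + size ms).-tuple bool) :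
  is_expr (comp_left (i := i) A u B) -> is_expr (m1 :: ms) -> count id c == size B ->
  is_expr (comp_term A u B m1 ms c).
Proof.
move=> /is_exprP[w0 uw mw] /is_exprP[m0 um mm] /eqP cB; apply/is_exprP.
have inl_inj : injective (@inl (del i) J) by move=> ? ? [].
have inr_inj : injective (@inr (del i) J) by move=> ? ? [].
set inA := map (map (@inl (del i) J)); set inM := map (map (@inr (del i) J)).
have pw : perm_eq (weave c (inA B) (inM ms)) (inA B ++ inM ms).
  by apply: perm_weave; rewrite ?size_tuple /inA /inM !size_map.
set v := flatten A ++ u ++ flatten B.
have pv : perm_eq (flatten (comp_left A u B)) (i :: map val v).
  apply/permP => a; rewrite /comp_left /v flatten_cat /= -!map_flatten !map_cat.
  rewrite -cats1 /= !count_cat /= addn0 [RHS]addnCA; congr addn.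
  by rewrite -addnA addnCA.
have pt : perm_eq (flatten (comp_term A u B m1 ms c))
    (map inl v ++ map inr (flatten (m1 :: ms))).
  rewrite /comp_term flatten_cat /= -map_flatten /v !map_cat -!catA perm_cat2l.
  rewrite perm_cat2l; apply: (@perm_trans _ (map inr m1 ++ flatten (inA B ++ inM ms))).
    by rewrite perm_cat2l; apply: perm_flatten.
  by rewrite flatten_cat -!map_flatten perm_catCA.
move: uw; rewrite (perm_uniq pv) /= => /andP[_]; rewrite (map_inj_uniq val_inj) => uv.
have mv x : x \in v.
  have := mw (val x); rewrite (perm_mem pv) in_cons (negPf (valP x)) /=.
  by rewrite mem_map //; apply: val_inj.
split.
- move: w0 m0; rewrite !mem_cat !in_cons (perm_mem pw) mem_cat !nil_map.
  rewrite !negb_or => /and3P[-> _ ->] /andP[m0 ->]; rewrite andbT /=.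
  by case: (m1) m0 => // ? ?; case: (u).
- rewrite (perm_uniq pt) cat_uniq !map_inj_uniq // uv um andbT /=.
  by apply/hasPn => x /mapP[y _ ->]; apply/mapP => -[].
- by case=> x; rewrite (perm_mem pt) mem_cat ?map_f ?orbT.
Qed.

(* Main.v *)
Require Import Defs.
From mathcomp Require Import all_boot all_order all_algebra.
From mathcomp Require Import generic_quotient.
From mathcomp Require Import boolp freeg.
From mathcomp Require Import zify.

(** Each structure map of Pi is described on words, that is, on sequences of
    blocks with letters in any set, as a signed sum of words: the differential
    merges two consecutive blocks, and the composition replaces the letter i by
    the first block of the second word, the rest of which is shuffled with the
    blocks that follow. The axioms of operads are then identities between signed
    sums of words, proved by induction on words.

    The right way to read the signs is that a block of p letters is an odd object
    for each of its letters, and for the block itself; then the signs are those of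
    the Koszul rule. In particular, the letter i need not be at the end of its
    block u /\ i /\ v: the block m1 that replaces it has to move across v, which
    costs the sign of dim(m1) |v|, and the composition has the same sign when i is
    first moved to the end.

    The shuffle product is graded commutative (shufC), associative (shufA), and
    the differential is a derivation of it (der_shuf): the mergings of a block of
    one factor with a block of the other come in pairs a /\ b, b /\ a, which cancel
    by antisymmetry. A substitution in one factor of a shuffle commutes with the shuffle
    (subst_shufr, subst_shufl). By induction on the word in which the letters are
    replaced, these facts give the compatibility of the substitution with the
    differential (der_subst), and the two associativity axioms (subst_subst,
    subst_par): when the relevant letter is reached, what is left to prove is
    about shuffles.

    Pi(I) is a quotient by the antisymmetry relations. A function of words that
    changes sign when two adjacent letters of a block are exchanged extends to
    Pi(I) (extend), and so do identities between additive maps that hold on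
    generators (Pi_morph_ext). The sets involved in an axiom, such as
    (((I \ {i}) |_| J) \ {j}) |_| K, all embed in one set T such as I |_| J |_| K.
    Elements of Pi are represented by words in T (place), in terms of which the
    structure maps become the operations on words (Pi_d_place, Pi_act_place,
    Pi_comp_place), and the canonical bijections disappear. *)

Set Implicit Arguments.
Unset Strict Implicit.
Unset Printing Implicit Defensive.

Import GRing.Theory.
Local Open Scope ring_scope.

(** * Signed sums *)

Definition sg (V : zmodType) (b : bool) (x : V) : V := if b then - x else x.

Section Sign.
Variable V : zmodType.
Implicit Types (x y : V) (b c : bool).

Lemma sgD b x y : sg b (x + y) = sg b x + sg b y.
Proof. by case: b; rewrite //= opprD. Qed.

Lemma sg0 b : sg b (0 : V) = 0.
Proof. by case: b; rewrite //= oppr0. Qed.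

Lemma sgN b x : sg b (- x) = - sg b x.
Proof. by case: b. Qed.

Lemma sg_cancel b c x : b = ~~ c -> sg b x + sg c x = 0.
Proof. by move=> ->; case: c; rewrite /= ?addrN ?addNr. Qed.

Lemma sg_sg b c x : sg b (sg c x) = sg (b (+) c) x.
Proof. by case: b c => -[] //=; rewrite opprK. Qed.

Lemma sgE n x : x *~ ((-1) ^+ n) = sg (odd n) x.
Proof. by rewrite -signr_odd; case: (odd n) => //=; rewrite expr1 mulrN1z. Qed.

Lemma sgEz n x : x *~ ((-1) ^ n) = sg (odd `|n|) x.
Proof.
case: n => n; first by rewrite -exprnP sgE.
by rewrite NegzE -exprnN -exprVn invrN1 sgE.
Qed.

End Sign.

(** A signed sum of terms is a list L of pairs (sign, term), seen through the
    values of the linear extensions of functions phi from terms to abelian groups.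
    Identities between signed sums are stated for all phi: in a proof by induction
    on words, a block put in front of all terms is absorbed in phi. *)
Definition ssum (T : Type) (V : zmodType) (L : seq (bool * T)) (phi : T -> V) : V :=
  \sum_(p <- L) sg p.1 (phi p.2).

Notation "\ssum_ ( t <- L ) E" := (ssum L (fun t => E))
  (at level 41, t binder, L at level 50, E at level 41,
   format "\ssum_ ( t  <-  L )  E").

Definition smap (T U : Type) (c : bool) (f : T -> U) (L : seq (bool * T)) :=
  [seq (c (+) p.1, f p.2) | p <- L].

Section SignedSum.
Variables (T : Type) (V : zmodType).
Implicit Types (L : seq (bool * T)) (phi psi : T -> V).

Lemma ssum_nil phi : ssum [::] phi = 0.
Proof. exact: big_nil. Qed.

Lemma ssum_cat L M phi : ssum (L ++ M) phi = ssum L phi + ssum M phi.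
Proof. exact: big_cat. Qed.

Lemma ssum1 b t phi : ssum [:: (b, t)] phi = sg b (phi t).
Proof. exact: big_seq1. Qed.

Lemma ssum_map (U : Type) c (f : U -> T) (L : seq (bool * U)) phi :
  ssum (smap c f L) phi = sg c (\ssum_(t <- L) phi (f t)).
Proof.
rewrite /ssum big_map /= (big_morph (sg c) (sgD c) (sg0 V c)).
by apply: eq_bigr => p _; rewrite sg_sg.
Qed.

Lemma eq_ssum L phi psi : phi =1 psi -> ssum L phi = ssum L psi.
Proof. by move=> E; apply: eq_bigr => p _; rewrite E. Qed.

Lemma ssumD L phi psi : \ssum_(t <- L) (phi t + psi t) = ssum L phi + ssum L psi.
Proof. by rewrite /ssum -big_split; apply: eq_bigr => p _; rewrite sgD. Qed.

Lemma ssum_sg L c phi : \ssum_(t <- L) sg c (phi t) = sg c (ssum L phi).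
Proof.
rewrite /ssum (big_morph (sg c) (sgD c) (sg0 V c)).
by apply: eq_bigr => p _; rewrite !sg_sg addbC.
Qed.

Lemma ssum0 L : \ssum_(t <- L) (0 : V) = 0.
Proof. by apply: big1 => p _; rewrite sg0. Qed.

End SignedSum.

Lemma additive_ssum (T : Type) (U V : zmodType) (F : U -> V) (L : seq (bool * T)) phi :
  {morph F : x y / x + y} -> F (ssum L phi) = \ssum_(t <- L) F (phi t).
Proof.
move=> FD; have F0 : F 0 = 0 by apply: (addrI (F 0)); rewrite -FD !addr0.
have FN x : F (- x) = - F x by apply: (addrI (F x)); rewrite -FD !subrr.
rewrite /ssum (big_morph F FD F0); apply: eq_bigr => -[[] t] _ //=.
Qed.

Lemma eq_in_ssum (T : eqType) (V : zmodType) (L : seq (bool * T)) (phi psi : T -> V) :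
  (forall t, t \in map snd L -> phi t = psi t) -> ssum L phi = ssum L psi.
Proof. by move=> E; apply: eq_big_seq => p pL; rewrite E // map_f. Qed.

Lemma mem_smap (T U : eqType) c (f : T -> U) (L : seq (bool * T)) (u : U) :
  u \in map snd (smap c f L) -> exists2 t, t \in map snd L & u = f t.
Proof. by move=> /mapP[p /mapP[q qL ->] ->] /=; exists q.2; rewrite ?map_f. Qed.

(** * Words, shuffles and the derivation *)

(** The parity of the degree of a non-empty block. The parity of the size is used
    rather than that of [dim], whose value at the empty block breaks the relation
    dim(b /\ c) = dim(b) + dim(c) + 1. *)
Definition bpar (T : Type) (b : seq T) : bool := ~~ odd (size b).

Fixpoint wpar (T : Type) (w : seq (seq T)) : bool :=
  if w is b :: w' then bpar b (+) wpar w' else false.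

(* Equalities between signs are polynomial identities over F_2 in the parities
   of sizes of blocks and of degrees of words. *)
Ltac parity :=
  rewrite /= /bpar ?(size_cat, size_map) /= ?oddD /=;
  repeat match goal with
    | |- context [odd ?n] => case: (odd n)
    | |- context [wpar ?w] => case: (wpar w)
  end; reflexivity.

Section Shuffle.
Variable T : Type.
Implicit Types (b c : seq T) (s t r w : seq (seq T)).

(** In a shuffle whose first block is that of t, this block has moved across the
    whole of s, hence the sign. *)
Fixpoint shuf s : seq (seq T) -> seq (bool * seq (seq T)) :=
  if s is b :: s' then
    fix shuf_s t := if t is c :: t' then
        smap false (cons b) (shuf s' t) ++ smap (bpar c && wpar s) (cons c) (shuf_s t')
      else [:: (false, s)]
  else fun t => [:: (false, t)].

Definition merge_head b s := if s is c :: s' then [:: (false, (b ++ c) :: s')] else [::].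

(** The differential, in a recursive form suited to induction on words: [d_formulaE]
    turns it into the sum over the places where blocks are merged. The sign of b is
    the one for moving the differential across b, and it is also the sign of the
    merging of b with the next block. *)
Fixpoint der w : seq (bool * seq (seq T)) :=
  if w is b :: s then
    smap (bpar b) id (merge_head b s ++ smap false (cons b) (der s))
  else [::].

Section Evaluation.
Variable V : zmodType.
Implicit Types phi psi : seq (seq T) -> V.

Lemma shuf0s t phi : ssum (shuf [::] t) phi = phi t.
Proof. exact: ssum1. Qed.

Lemma shufs0 s phi : ssum (shuf s [::]) phi = phi s.
Proof. by case: s => [|b s]; exact: ssum1. Qed.

Lemma shuf_cons b s c t phi : ssum (shuf (b :: s) (c :: t)) phi =
  \ssum_(r <- shuf s (c :: t)) phi (b :: r)
  + sg (bpar c && wpar (b :: s)) (\ssum_(r <- shuf (b :: s) t) phi (c :: r)).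
Proof. by rewrite [shuf _ _]/= ssum_cat !ssum_map. Qed.

Lemma der_cons b s phi : ssum (der (b :: s)) phi =
  sg (bpar b) (ssum (merge_head b s) phi + \ssum_(s' <- der s) phi (b :: s')).
Proof. by rewrite ssum_map ssum_cat ssum_map. Qed.

Lemma shufC s t phi :
  ssum (shuf s t) phi = sg (wpar s && wpar t) (ssum (shuf t s) phi).
Proof.
elim: s t phi => [|b s IHs] t phi; first by rewrite shuf0s shufs0.
elim: t phi => [|c t IHt] phi; first by rewrite shufs0 andbF.
rewrite !shuf_cons IHs IHt addrC sgD !sg_sg; congr (sg _ _ + sg _ _); parity.
Qed.

End Evaluation.
End Shuffle.

Lemma wpar_shuf (T : eqType) (s t r : seq (seq T)) :
  r \in map snd (shuf s t) -> wpar r = wpar s (+) wpar t.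
Proof.
elim: s t r => [|b s IHs] t r; first by rewrite inE => /eqP->.
elim: t r => [|c t IHt] r; first by rewrite inE => /eqP->; rewrite addbF.
rewrite [shuf _ _]/= map_cat mem_cat => /orP[] /mem_smap[r' r'P ->] /=.
  by rewrite (IHs _ _ r'P) /= addbA.
by rewrite (IHt _ r'P) /= addbCA.
Qed.

Lemma wpar_der (T : eqType) (w r : seq (seq T)) :
  r \in map snd (der w) -> wpar r = ~~ wpar w.
Proof.
elim: w r => [|b s IHs] r //; rewrite [der _]/= => /mem_smap[{}r rP ->]; move: rP.
rewrite map_cat mem_cat => /orP[|/mem_smap[{}r /IHs rP ->]]; last by rewrite /= rP addbN.
case: s {IHs} => [|c s] //=; rewrite inE => /eqP->; parity.
Qed.

(** The shuffles of three words are classified by the word from which their first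
    block is taken. *)
Lemma shufA (T : eqType) (V : zmodType) (s t q : seq (seq T)) (phi : seq (seq T) -> V) :
  \ssum_(r <- shuf s t) ssum (shuf r q) phi = \ssum_(r <- shuf t q) ssum (shuf s r) phi.
Proof.
elim: s t q phi => [|b s IHs] t q phi.
  by rewrite shuf0s; apply: eq_ssum => r; rewrite shuf0s.
elim: t q phi => [|c t IHt] q phi; first by rewrite shufs0 shuf0s.
elim: q phi => [|d q IHq] phi.
  by rewrite shufs0; apply: eq_ssum => r; rewrite shufs0.
have E e u v (psi : seq (seq T) -> V) :
    \ssum_(r <- shuf u v) ssum (shuf (e :: r) (d :: q)) psi
    = \ssum_(r <- shuf u v) \ssum_(r' <- shuf r (d :: q)) psi (e :: r')
      + sg (bpar d && (bpar e (+) wpar u (+) wpar v))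
          (\ssum_(r <- shuf u v) \ssum_(r' <- shuf (e :: r) q) psi (d :: r')).
  rewrite -ssum_sg -ssumD; apply: eq_in_ssum => r /wpar_shuf rE.
  by rewrite shuf_cons /= rE addbA.
have Hb := IHs (c :: t) (d :: q) (fun r => phi (b :: r)).
rewrite [RHS]shuf_cons in Hb.
have Hd := IHq (fun r => phi (d :: r)); rewrite shuf_cons in Hd.
rewrite shuf_cons !E Hb IHt [RHS]shuf_cons.
under [X in _ = X + _]eq_ssum do rewrite shuf_cons.
under [X in _ = _ + sg _ X]eq_ssum do rewrite shuf_cons.
rewrite !ssumD !ssum_sg -Hd !sgD !sg_sg.
rewrite -!addrA; congr (_ + _); rewrite [RHS]addrCA; congr (_ + _).
rewrite [RHS]addrCA; congr (sg _ _ + (_ + sg _ _)); parity.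
Qed.

Section Leibniz.
Variables (T : eqType) (V : zmodType).
Implicit Types (b c : seq T) (s t r w : seq (seq T)) (phi psi : seq (seq T) -> V).

Definition alternating phi := forall A (u v : seq T) x y B,
  phi (A ++ (u ++ x :: y :: v) :: B) = - phi (A ++ (u ++ y :: x :: v) :: B).

Lemma alternating_cons phi b : alternating phi -> alternating (fun r => phi (b :: r)).
Proof. by move=> H A u v x y B; rewrite -!cat_cons H. Qed.

(** The letters of p move one at a time across those of q. *)
Lemma alternating_swap phi (u p q v : seq T) B : alternating phi ->
  phi ((u ++ p ++ q ++ v) :: B)
  = sg (odd (size p) && odd (size q)) (phi ((u ++ q ++ p ++ v) :: B)).
Proof.
move=> H; have H1 x : forall u' q' v', phi ((u' ++ x :: q' ++ v') :: B)
    = sg (odd (size q')) (phi ((u' ++ q' ++ x :: v') :: B)).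
  move=> u' q'; elim: q' u' => [|y q' IHq] u' v' //=.
  by rewrite (H [::]) /= -cat_rcons IHq -sgN cat_rcons; case: (odd _); rewrite //= opprK.
elim: p u v => [|x p IHp] u v //=.
rewrite -cat_rcons IHp cat_rcons H1 sg_sg /=.
by congr (sg _ _); case: (odd (size p)); case: (odd _).
Qed.

Definition on_head (f : seq T -> seq (seq T) -> V) s := if s is c :: s' then f c s' else 0.

Lemma ssum_merge_head b s phi :
  ssum (merge_head b s) phi = on_head (fun c s' => phi ((b ++ c) :: s')) s.
Proof. by case: s => [|c s]; rewrite /= ?ssum_nil ?ssum1. Qed.

(** The block merged with b is the first block of s, or that of t, which has then
    moved across s. *)
Lemma shuf_merge_head b s t phi :
  \ssum_(r <- shuf s t) ssum (merge_head b r) phi =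
    on_head (fun c s' => \ssum_(r <- shuf s' t) phi ((b ++ c) :: r)) s
  + on_head (fun c t' => sg (bpar c && wpar s) (\ssum_(r <- shuf s t') phi ((b ++ c) :: r))) t.
Proof.
case: s => [|c s].
  rewrite shuf0s ssum_merge_head add0r; case: t => [|c t] //=.
  by rewrite andbF shuf0s.
case: t => [|d t]; first by rewrite shufs0 ssum_merge_head addr0 /= shufs0.
rewrite shuf_cons; congr (_ + sg _ _); apply: eq_ssum => r; exact: ssum1.
Qed.

(** Mergings of two blocks of s, or of two blocks of t, give the two terms of the
    right-hand side. A block b of s and a block c of t get merged in the shuffles
    where they are neighbours, once as b /\ c and once as c /\ b: the signs of the
    shuffle, of the differential and of antisymmetry combine so that these two
    terms cancel. *)
Lemma der_shuf s t phi : alternating phi ->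
  \ssum_(r <- shuf s t) ssum (der r) phi =
    \ssum_(s' <- der s) ssum (shuf s' t) phi
  + sg (wpar s) (\ssum_(t' <- der t) ssum (shuf s t') phi).
Proof.
elim: s t phi => [|b s IHs] t phi phiA.
  by rewrite shuf0s ssum_nil add0r; apply: eq_ssum => r; rewrite shuf0s.
elim: t phi phiA => [|c t IHt] phi phiA.
  rewrite shufs0 ssum_nil sg0 addr0; apply: eq_ssum => r; by rewrite shufs0.
have phiB := alternating_cons b phiA; have phiC := alternating_cons c phiA.
have Es r : r \in map snd (der s) -> \ssum_(q <- shuf (b :: r) (c :: t)) phi q =
    \ssum_(q <- shuf r (c :: t)) phi (b :: q) +
    sg (bpar c && ~~ wpar (b :: s)) (\ssum_(q <- shuf (b :: r) t) phi (c :: q)).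
  by move=> /wpar_der rP; rewrite shuf_cons /= rP addbN.
have Et r : \ssum_(q <- shuf (b :: s) (c :: r)) phi q =
    \ssum_(q <- shuf s (c :: r)) phi (b :: q) +
    sg (bpar c && wpar (b :: s)) (\ssum_(q <- shuf (b :: s) r) phi (c :: q)).
  by rewrite shuf_cons.
rewrite shuf_cons.
under eq_ssum do rewrite der_cons.
under [X in _ + sg _ X]eq_ssum do rewrite der_cons.
rewrite !ssum_sg !ssumD !shuf_merge_head IHs // IHt //.
rewrite !(der_cons c) !(der_cons b s) !ssum_merge_head.
rewrite (eq_in_ssum Es) !ssumD ssum_sg (eq_ssum _ Et) !ssumD !ssum_sg.
have Hs : on_head (fun d s' => ssum (shuf ((b ++ d) :: s') (c :: t)) phi) s =
    on_head (fun d s' => \ssum_(r <- shuf s' (c :: t)) phi ((b ++ d) :: r)) s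
  + sg (bpar c && ~~ wpar (b :: s))
     (on_head (fun d s' => \ssum_(r <- shuf ((b ++ d) :: s') t) phi (c :: r)) s).
  case: (s) => [|d s'] /=; first by rewrite sg0 addr0.
  rewrite shuf_cons; congr (_ + sg _ _); parity.
have Ht : on_head (fun d t' => ssum (shuf (b :: s) ((c ++ d) :: t')) phi) t =
    on_head (fun d t' => \ssum_(r <- shuf s ((c ++ d) :: t')) phi (b :: r)) t
  + sg (~~ bpar c && wpar (b :: s))
     (on_head (fun d t' => sg (bpar d && wpar (b :: s))
                   (\ssum_(r <- shuf (b :: s) t') phi ((c ++ d) :: r))) t).
  case: (t) => [|d t'] /=; first by rewrite sg0 addr0.
  rewrite shuf_cons sg_sg; congr (_ + sg _ _); parity.
have Hbc : \ssum_(r <- shuf s t) phi ((c ++ b) :: r)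
    = sg (~~ bpar b && ~~ bpar c) (\ssum_(r <- shuf s t) phi ((b ++ c) :: r)).
  rewrite -ssum_sg; apply: eq_ssum => r.
  have := @alternating_swap _ [::] c b [::] r phiA; rewrite /= !cats0 => ->.
  congr (sg _ _); parity.
rewrite Hs Ht /= Hbc !sgD !sg_sg.
rewrite [LHS](AC ((2*(1*2))*(2*(2*1))) ((2*6)*(((1*8)*(3*9))*((4*7)*(5*10))))) /=.
(* x1 and x2 are the mergings of the heads b and c of the two words. *)
set x1 := (X in X + _ + _ = _); set x2 := (X in _ + X + _ = _).
have -> : x1 + x2 = 0 by apply: sg_cancel; parity.
rewrite add0r.
congr (sg _ _ + sg _ _ + (sg _ _ + sg _ _) + (sg _ _ + sg _ _ + (sg _ _ + sg _ _))); parity.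
Qed.

(** * Substitution of a word for a letter *)

(** In the sign, m1 moves across the blocks that follow and across the letters of
    v. If a is first brought to the end of its block u /\ a /\ v, the same sign is
    found: a moves across v, and then m1, of size dim(m1) + 1, moves back across
    v. *)
Fixpoint subst (a : T) w (m : seq (seq T)) : seq (bool * seq (seq T)) :=
  if w is b :: w' then
    if a \in b then
      if m is m1 :: ms then
        let u := take (index a b) b in
        let v := drop (index a b).+1 b in
        smap (bpar m1 && (odd (size v) (+) wpar w')) (cons (u ++ m1 ++ v)) (shuf w' ms)
      else [::]
    else smap false (cons b) (subst a w' m)
  else [::].

Lemma first_occurrence (a : T) b : a \in b ->
  exists u v, [/\ b = u ++ a :: v, a \notin u & index a b = size u].
Proof.
elim: b => [|x b IHb] //=; rewrite inE eq_sym; case: eqVneq => [<- _|xa /= /IHb[u [v [E au iE]]]].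
  by exists [::], b.
exists (x :: u), v; split; rewrite /= ?E // ?iE ?inE ?negb_or //.
  by rewrite eq_sym xa.
by rewrite -E iE.
Qed.

Section SubstEvaluation.
Variable a : T.

Lemma subst_nil w phi : ssum (subst a w [::]) phi = 0.
Proof.
elim: w phi => [|c w IHw] phi; first exact: ssum_nil.
by rewrite /=; case: ifP => _; rewrite ?ssum_nil // ssum_map IHw.
Qed.

Lemma subst_skip c w m phi : a \notin c ->
  ssum (subst a (c :: w) m) phi = \ssum_(r <- subst a w m) phi (c :: r).
Proof. by move=> /negPf ac; rewrite /= ac ssum_map. Qed.

Lemma subst_here u v w m1 ms phi : a \notin u ->
  ssum (subst a ((u ++ a :: v) :: w) (m1 :: ms)) phi =
  sg (bpar m1 && (odd (size v) (+) wpar w))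
     (\ssum_(r <- shuf w ms) phi ((u ++ m1 ++ v) :: r)).
Proof.
move=> au; rewrite /= mem_cat inE eqxx orbT ssum_map index_cat (negPf au) /= eqxx addn0.
by rewrite take_size_cat // -cat_rcons drop_size_cat ?size_rcons.
Qed.

Lemma subst_notin w m phi : a \notin flatten w -> ssum (subst a w m) phi = 0.
Proof.
elim: w phi => [|c w IHw] phi; first by rewrite ssum_nil.
by rewrite /= mem_cat negb_or => /andP[ac aw]; rewrite (negPf ac) ssum_map IHw.
Qed.

End SubstEvaluation.

Lemma wpar_subst a w m r : r \in map snd (subst a w m) -> wpar r = wpar w (+) wpar m.
Proof.
elim: w r => [|c w IHw] r //=; case: ifP => [ac|_]; last first.
  by move=> /mem_smap[{}r /IHw rP ->]; rewrite /= rP addbA.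
case: m {IHw} => [|m1 ms] // /mem_smap[{}r /wpar_shuf rP ->]; rewrite [LHS]/= rP.
have [u [v [-> au ->]]] := first_occurrence ac.
rewrite take_size_cat // -cat_rcons drop_size_cat ?size_rcons // cat_rcons; parity.
Qed.

(** In both orders of the operations, each block of m moves across the same blocks
    of s and t, namely those that come after it in the result. *)
Lemma subst_shufr (a : T) s t m phi : a \notin flatten s ->
  \ssum_(r <- shuf s t) ssum (subst a r m) phi =
  \ssum_(t' <- subst a t m) ssum (shuf s t') phi.
Proof.
case: m => [|m1 ms] aS.
  by rewrite subst_nil; under eq_ssum do rewrite subst_nil; rewrite ssum0.
elim: s t phi aS => [|b s IHs] t phi aS.
  by rewrite shuf0s; apply: eq_ssum => r; rewrite shuf0s.
elim: t phi => [|c t IHt] phi; first by rewrite shufs0 subst_notin ?ssum_nil //.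
have [ab as'] : a \notin b /\ a \notin flatten s by apply/andP; rewrite -negb_or -mem_cat.
rewrite shuf_cons; under eq_ssum do rewrite subst_skip //.
rewrite IHs //.
have [ac|ac] := boolP (a \in c); last first.
  under [X in _ + sg _ X]eq_ssum do rewrite subst_skip //.
  rewrite !subst_skip // IHt -ssum_sg -ssumD. apply: eq_ssum => r.
  by rewrite shuf_cons.
have [u [v [-> au _]]] := first_occurrence ac.
have E r : r \in map snd (shuf (b :: s) t) ->
    ssum (subst a ((u ++ a :: v) :: r) (m1 :: ms)) phi
    = sg (bpar m1 && (odd (size v) (+) (wpar (b :: s) (+) wpar t)))
        (\ssum_(r' <- shuf r ms) phi ((u ++ m1 ++ v) :: r')).
  by move=> /wpar_shuf rP; rewrite subst_here // rP.
rewrite (eq_in_ssum E) ssum_sg shufA !subst_here //.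
under [X in _ = sg _ X]eq_ssum do rewrite shuf_cons.
rewrite ssumD ssum_sg sgD !sg_sg; congr (_ + sg _ _); parity.
Qed.

(** Here m comes after t on the left-hand side, and before t on the right-hand
    side. *)
Lemma subst_shufl (a : T) s t m phi : a \notin flatten t ->
  \ssum_(r <- shuf s t) ssum (subst a r m) phi =
  sg (wpar t && wpar m) (\ssum_(s' <- subst a s m) ssum (shuf s' t) phi).
Proof.
move=> aT; rewrite shufC subst_shufr // -ssum_sg -ssum_sg; apply: eq_in_ssum => r.
by move=> /wpar_subst rP; rewrite shufC rP sg_sg; congr (sg _ _); parity.
Qed.

(** If b is in the first block of m, it ends up in the block of w that contained
    a, and the identity reduces to the associativity of the shuffles of n, of the
    rest of m and of the rest of w. Otherwise b is in one of the blocks of m that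
    are shuffled, and [subst_shufr] applies. *)
Lemma subst_subst (a b : T) w m n phi : b \notin flatten w ->
  \ssum_(r <- subst a w m) ssum (subst b r n) phi =
  \ssum_(q <- subst b m n) ssum (subst a w q) phi.
Proof.
case: m => [|m1 ms] bw; first by rewrite subst_nil !ssum_nil.
case: n => [|n1 ns].
  rewrite subst_nil; under eq_ssum do rewrite subst_nil; by rewrite ssum0.
elim: w phi bw => [|c w IHw] phi.
  by rewrite ssum_nil; under [RHS]eq_ssum do rewrite ssum_nil; rewrite ssum0.
rewrite [flatten _]/= mem_cat negb_or => /andP[bc bw].
have [ac|ac] := boolP (a \in c); last first.
  rewrite subst_skip //; under eq_ssum do rewrite subst_skip //.
  by rewrite IHw //; apply: eq_ssum => r; rewrite subst_skip.
have [u [v [cE au _]]] := first_occurrence ac; move: bc; rewrite {}cE {ac}.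
rewrite mem_cat inE !negb_or => /and3P[bu ba bv].
rewrite subst_here //.
have [bm|bm] := boolP (b \in m1); last first.
  have bumv : b \notin u ++ m1 ++ v by rewrite !mem_cat !negb_or bu bm.
  under eq_ssum do rewrite subst_skip //.
  rewrite subst_skip // subst_shufr // -ssum_sg; apply: eq_ssum => r.
  by rewrite subst_here.
have [u' [v' [-> bu' _]]] := first_occurrence bm.
have buu : b \notin u ++ u' by rewrite mem_cat negb_or bu.
have E r : r \in map snd (shuf w ms) ->
    ssum (subst b ((u ++ (u' ++ b :: v') ++ v) :: r) (n1 :: ns)) phi
    = sg (bpar n1 && (odd (size (v' ++ v)) (+) (wpar w (+) wpar ms)))
        (\ssum_(r' <- shuf r ns) phi ((u ++ (u' ++ n1 ++ v') ++ v) :: r')).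
  move=> /wpar_shuf rP; rewrite -!catA [u ++ u' ++ _]catA cat_cons subst_here // rP.
  by rewrite -!catA.
have E' r : r \in map snd (shuf ms ns) ->
    ssum (subst a ((u ++ a :: v) :: w) ((u' ++ n1 ++ v') :: r)) phi
    = sg (bpar (u' ++ n1 ++ v') && (odd (size v) (+) wpar w))
        (\ssum_(r' <- shuf w r) phi ((u ++ (u' ++ n1 ++ v') ++ v) :: r')).
  by move=> _; rewrite subst_here.
rewrite (eq_in_ssum E) subst_here // (eq_in_ssum E') !ssum_sg shufA !sg_sg.
congr (sg _ _); parity.
Qed.

(** The first block containing a or b is u /\ a /\ v, in which a comes first. If b is
    in v, the identity follows from the associativity and the commutativity of
    shuffles: n1 has to move across the rest of m on one side, m1 across n1 and
    the rest of n on the other side. If b occurs later, [subst_shufl] applies. *)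
Lemma subst_par_ordered (a b : T) u v w m n phi :
  a != b -> a \notin u -> b \notin u ->
  b \notin flatten m -> a \notin flatten n ->
  \ssum_(r <- subst a ((u ++ a :: v) :: w) m) ssum (subst b r n) phi =
  sg (wpar m && wpar n)
    (\ssum_(r <- subst b ((u ++ a :: v) :: w) n) ssum (subst a r m) phi).
Proof.
move=> ab au bu.
case: m => [|m1 ms].
  by rewrite subst_nil; under [X in sg _ X]eq_ssum do rewrite subst_nil; rewrite ssum0 sg0.
case: n => [|n1 ns].
  by rewrite subst_nil sg0; under eq_ssum do rewrite subst_nil; rewrite ssum0.
rewrite [flatten _]/= mem_cat negb_or => /andP[bm1 bms].
rewrite [flatten _]/= mem_cat negb_or => /andP[an1 ans].
rewrite subst_here //.
have [bv|bv] := boolP (b \in v); last first.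
  have bumv : b \notin u ++ m1 ++ v by rewrite !mem_cat !negb_or bu bm1.
  have buav : b \notin u ++ a :: v by rewrite mem_cat inE !negb_or bu eq_sym ab.
  under eq_ssum do rewrite subst_skip //.
  rewrite subst_shufl // subst_skip //.
  have E r : r \in map snd (subst b w (n1 :: ns)) ->
      ssum (subst a ((u ++ a :: v) :: r) (m1 :: ms)) phi
      = sg (bpar m1 && (odd (size v) (+) (wpar w (+) wpar (n1 :: ns))))
          (\ssum_(r' <- shuf r ms) phi ((u ++ m1 ++ v) :: r')).
    by move=> /wpar_subst rP; rewrite subst_here // rP.
  rewrite (eq_in_ssum E) ssum_sg !sg_sg; congr (sg _ _); parity.
have [v1 [v2 [-> bv1 _]]] := first_occurrence bv.
have bumv : b \notin u ++ m1 ++ v1 by rewrite !mem_cat !negb_or bu bm1.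
have buav : b \notin u ++ a :: v1 by rewrite mem_cat inE !negb_or bu eq_sym ab.
have E r : r \in map snd (shuf w ms) ->
    ssum (subst b ((u ++ m1 ++ v1 ++ b :: v2) :: r) (n1 :: ns)) phi
    = sg (bpar n1 && (odd (size v2) (+) (wpar w (+) wpar ms)))
        (\ssum_(r' <- shuf r ns) phi ((u ++ m1 ++ v1 ++ n1 ++ v2) :: r')).
  move=> /wpar_shuf rP; have := subst_here v2 r n1 ns phi bumv.
  by rewrite -!catA rP.
have E' r : r \in map snd (shuf w ns) ->
    ssum (subst a ((u ++ a :: v1 ++ n1 ++ v2) :: r) (m1 :: ms)) phi
    = sg (bpar m1 && (odd (size (v1 ++ n1 ++ v2)) (+) (wpar w (+) wpar ns)))
        (\ssum_(r' <- shuf r ms) phi ((u ++ m1 ++ v1 ++ n1 ++ v2) :: r')).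
  by move=> /wpar_shuf rP; rewrite subst_here // rP.
have := subst_here v2 w n1 ns (fun r => ssum (subst a r (m1 :: ms)) phi) buav.
rewrite -!catA !cat_cons => ->.
rewrite (eq_in_ssum E) (eq_in_ssum E') !ssum_sg !sg_sg !shufA.
rewrite [X in _ = sg _ X]shufC sg_sg; congr (sg _ _); parity.
Qed.

(** The statement is symmetric in (a, m) and (b, n), so that a may be assumed to
    occur before b. *)
Lemma subst_par (a b : T) w m n phi :
  a != b -> b \notin flatten m -> a \notin flatten n ->
  \ssum_(r <- subst a w m) ssum (subst b r n) phi =
  sg (wpar m && wpar n) (\ssum_(r <- subst b w n) ssum (subst a r m) phi).
Proof.
move=> ab bm an.
have sym (X Y : V) : Y = sg (wpar n && wpar m) X -> X = sg (wpar m && wpar n) Y.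
  by move=> ->; rewrite sg_sg andbC addbb.
have ba : b != a by rewrite eq_sym.
elim: w phi => [|c w IHw] phi; first by rewrite !ssum_nil sg0.
have [ac|ac] := boolP (a \in c).
  have [u [v [-> au _]]] := first_occurrence ac.
  have [bu|bu] := boolP (b \in u); last exact: subst_par_ordered.
  have [u1 [v1 [uE bu1 _]]] := first_occurrence bu; apply: sym; move: au.
  rewrite uE mem_cat inE !negb_or => /and3P[au1 _ _]; rewrite -catA cat_cons.
  exact: subst_par_ordered.
have [bc|bc] := boolP (b \in c).
  have [u [v [cE bu _]]] := first_occurrence bc; apply: sym; move: ac.
  rewrite cE mem_cat inE !negb_or => /and3P[au _ _].
  exact: subst_par_ordered.
rewrite !subst_skip //.
under eq_ssum do rewrite subst_skip //; under [X in sg _ X]eq_ssum do rewrite subst_skip //.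
exact: IHw.
Qed.

(** Up to the block that contains a, mergings on both sides correspond to each
    other. That block becomes b' = u /\ m1 /\ v, followed by a shuffle of the rest
    of w with the rest of m. The merging of b' with the first block of the shuffle
    comes from a merging of u /\ a /\ v in w, or from a merging of m1 in m; in the
    latter case, the block m2 ends up before v instead of after it, hence the use
    of antisymmetry. The mergings further on are treated by [der_shuf]. *)
Lemma der_subst (a : T) w m phi : alternating phi ->
  \ssum_(r <- subst a w m) ssum (der r) phi =
    \ssum_(w' <- der w) ssum (subst a w' m) phi
  + sg (wpar w) (\ssum_(m' <- der m) ssum (subst a w m') phi).
Proof.
case: m => [|m1 ms].
  rewrite subst_nil ssum_nil sg0 addr0; under eq_ssum do rewrite subst_nil.
  by rewrite ssum0.
elim: w phi => [|b w IHw] phi phiA.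
  by rewrite !ssum_nil add0r; under eq_ssum do rewrite ssum_nil; rewrite ssum0 sg0.
have phiB := alternating_cons b phiA.
rewrite [X in _ = X + _]der_cons ssum_merge_head.
have [ab|ab] := boolP (a \in b); last first.
  rewrite subst_skip //; under eq_ssum do rewrite der_cons.
  under [X in sg _ (_ + X)]eq_ssum do rewrite subst_skip //.
  under [X in _ + sg _ X]eq_ssum do rewrite subst_skip //.
  rewrite ssum_sg ssumD IHw // !sgD sg_sg addrA; congr (_ + _ + _).
  congr (sg _ _); case: (w) => [|c w']; first exact: ssum_nil.
  rewrite [on_head _ _]/=.
  have [ac|ac] := boolP (a \in c); last first.
    have abc : a \notin b ++ c by rewrite mem_cat negb_or ab.
    rewrite !subst_skip //; apply: eq_ssum => r; exact: ssum1.
  have [u [v [-> au _]]] := first_occurrence ac.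
  have abu : a \notin b ++ u by rewrite mem_cat negb_or ab.
  rewrite catA !subst_here //; congr (sg _ _); apply: eq_ssum => r.
  by rewrite ssum1 /= catA.
have [u [v [-> au _]]] := first_occurrence ab.
set b' := u ++ m1 ++ v.
rewrite subst_here //; under eq_ssum do rewrite der_cons.
rewrite ssum_sg ssumD shuf_merge_head der_shuf; last exact: alternating_cons.
have Ew r : r \in map snd (der w) ->
    ssum (subst a ((u ++ a :: v) :: r) (m1 :: ms)) phi =
    sg (bpar m1 && (odd (size v) (+) ~~ wpar w)) (\ssum_(r' <- shuf r ms) phi (b' :: r')).
  by move=> /wpar_der rP; rewrite subst_here // rP.
rewrite (eq_in_ssum Ew) ssum_sg.
rewrite der_cons ssum_merge_head.
have Em r : ssum (subst a ((u ++ a :: v) :: w) (m1 :: r)) phi =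
    sg (bpar m1 && (odd (size v) (+) wpar w)) (\ssum_(r' <- shuf w r) phi (b' :: r')).
  by rewrite subst_here.
rewrite (eq_ssum _ Em) ssum_sg.
have Hw : on_head (fun c w' => ssum (subst a (((u ++ a :: v) ++ c) :: w') (m1 :: ms)) phi) w
  = sg (bpar m1 && (odd (size v) (+) ~~ wpar w))
     (on_head (fun c s' => \ssum_(r <- shuf s' ms) phi ((b' ++ c) :: r)) w).
  case: (w) => [|c w']; first by rewrite sg0.
  rewrite [LHS]/= [on_head _ _]/=.
  by rewrite -catA cat_cons subst_here // /b' -!catA; congr (sg _ _); parity.
have Hm : on_head (fun c m' => ssum (subst a ((u ++ a :: v) :: w) ((m1 ++ c) :: m')) phi) ms
  = sg (bpar m1 && (odd (size v) (+) wpar w) (+) wpar w)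
     (on_head (fun c t' => sg (bpar c && wpar w)
        (\ssum_(r <- shuf w t') phi ((b' ++ c) :: r))) ms).
  case: (ms) => [|c m']; first by rewrite sg0.
  rewrite [LHS]/= [on_head _ _]/=.
  have Ec r : phi ((u ++ (m1 ++ c) ++ v) :: r)
      = sg (odd (size c) && odd (size v)) (phi ((b' ++ c) :: r)).
    by have := @alternating_swap _ (u ++ m1) c v [::] r phiA; rewrite !cats0 /b' -!catA.
  rewrite subst_here // (eq_ssum _ Ec) ssum_sg !sg_sg; congr (sg _ _); parity.
rewrite Hw Hm !sgD !sg_sg.
rewrite [RHS](AC (2*2) ((1*3)*(2*4))) /=.
congr (sg _ _ + sg _ _ + (sg _ _ + sg _ _)); rewrite /b'; parity.
Qed.
End Leibniz.

(** * Alternating functions, letters and sizes of the terms *)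

Section RawComplements.
Variables (T : eqType) (V : zmodType).
Implicit Types (b c : seq T) (s t r w : seq (seq T)) (phi psi : seq (seq T) -> V).

(** Two mergings at distinct places occur in two orders, with opposite signs since
    the one on the left changes the parity of what the other one moves across. *)
Lemma der_der w phi : \ssum_(r <- der w) ssum (der r) phi = 0.
Proof.
elim: w phi => [|b s IHs] phi; first by rewrite ssum_nil.
rewrite der_cons.
have Es r : ssum (der (b :: r)) phi =
    sg (bpar b) (ssum (merge_head b r) phi + \ssum_(s' <- der r) phi (b :: s')).
  exact: der_cons.
rewrite (eq_ssum _ Es) ssum_sg ssumD IHs addr0.
case: s {IHs Es} => [|c s]; first by rewrite !ssum_nil sg0 addr0 sg0.
rewrite [merge_head _ _]/= ssum1 [sg false _]/= !der_cons !ssum_merge_head.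
have Ec r : ssum (merge_head b (c :: r)) phi = phi ((b ++ c) :: r) by exact: ssum1.
rewrite (eq_ssum _ Ec).
have -> : on_head (fun d s' => ssum (merge_head b ((c ++ d) :: s')) phi) s
    = on_head (fun d s' => phi (((b ++ c) ++ d) :: s')) s.
  by case: s => [|d s] //=; rewrite ssum1 /= catA.
rewrite sg_sg sg_cancel ?sg0 //; parity.
Qed.

Lemma der_alternating A (u : seq T) x y v B phi : alternating phi ->
  ssum (der (A ++ (u ++ x :: y :: v) :: B)) phi
  = - ssum (der (A ++ (u ++ y :: x :: v) :: B)) phi.
Proof.
elim: A phi => [|c A IHA] phi phiA.
  rewrite !cat0s !der_cons -sgN opprD.
  have -> : bpar (u ++ x :: y :: v) = bpar (u ++ y :: x :: v) by parity.
  congr (sg _ (_ + _)).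
    rewrite !ssum_merge_head; case: B => [|c B]; rewrite /= ?oppr0 // -!catA.
    exact: (phiA [::]).
  rewrite -[RHS]/(sg true _) -ssum_sg; apply: eq_ssum => r; exact: (phiA [::]).
rewrite !cat_cons !der_cons -sgN opprD IHA; last exact: alternating_cons.
congr (sg _ (_ + _)); rewrite !ssum_merge_head; case: (A) => [|c' A'] /=.
  by have := phiA [::] (c ++ u) v x y B; rewrite /= -!catA.
exact: (phiA ((c ++ c') :: A')).
Qed.

Lemma shuf_alternatingr s A (u : seq T) x y v B phi : alternating phi ->
  ssum (shuf s (A ++ (u ++ x :: y :: v) :: B)) phi
  = - ssum (shuf s (A ++ (u ++ y :: x :: v) :: B)) phi.
Proof.
elim: s A phi => [|b s IHs] A phi phiA; first by rewrite !shuf0s phiA.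
have phiB := alternating_cons b phiA.
elim: A phi phiA phiB => [|c A IHA] phi phiA phiB.
  rewrite !cat0s !shuf_cons opprD -sgN; congr (_ + _); first exact: (IHs [::]).
  have -> : bpar (u ++ x :: y :: v) = bpar (u ++ y :: x :: v) by parity.
  congr (sg _ _); rewrite -[RHS]/(sg true _) -ssum_sg; apply: eq_ssum => r.
  exact: (phiA [::]).
rewrite !cat_cons !shuf_cons opprD -sgN -!cat_cons; congr (_ + sg _ _); first exact: IHs.
have phiC := alternating_cons c phiA; exact: IHA phiC (alternating_cons b phiC).
Qed.

Lemma wpar_swap A (u : seq T) x y v B :
  wpar (A ++ (u ++ x :: y :: v) :: B) = wpar (A ++ (u ++ y :: x :: v) :: B).
Proof. by elim: A => [|c A /= ->] //; parity. Qed.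

Lemma shuf_alternatingl t A (u : seq T) x y v B phi : alternating phi ->
  ssum (shuf (A ++ (u ++ x :: y :: v) :: B) t) phi
  = - ssum (shuf (A ++ (u ++ y :: x :: v) :: B) t) phi.
Proof.
by move=> phiA; rewrite ![ssum (shuf (_ ++ _) t) _]shufC shuf_alternatingr // wpar_swap sgN.
Qed.

Lemma subst_alternatingr (a : T) w A (u : seq T) x y v B phi : alternating phi ->
  ssum (subst a w (A ++ (u ++ x :: y :: v) :: B)) phi
  = - ssum (subst a w (A ++ (u ++ y :: x :: v) :: B)) phi.
Proof.
elim: w phi => [|c w IHw] phi phiA; first by rewrite !ssum_nil oppr0.
have [ac|ac] := boolP (a \in c); last first.
  by rewrite !subst_skip //; apply: IHw; apply: alternating_cons.
have [u' [v' [-> au _]]] := first_occurrence ac.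
case: (A) => [|m1 A']; last first.
  rewrite !cat_cons !subst_here // shuf_alternatingr ?sgN //; exact: alternating_cons.
rewrite !cat0s !subst_here //.
have -> : bpar (u ++ x :: y :: v) = bpar (u ++ y :: x :: v) by parity.
rewrite -sgN; congr (sg _ _); rewrite -[RHS]/(sg true _) -ssum_sg; apply: eq_ssum => r.
by have := phiA [::] (u' ++ u) (v ++ v') x y r; rewrite /= -!catA.
Qed.

(** The case that carries the lemma is the one where a is exchanged with its
    neighbour y (the fact [here] of the proof). The block m1 then moves across one
    letter less, which changes the sign by the parity of dim(m1), whereas y moves
    across the letters of m1, of which there are dim(m1) + 1. The condition x != y
    excludes that both letters be a: only the first of them would be replaced. *)
Lemma subst_alternatingl (a : T) m A (u : seq T) x y v B phi : x != y -> alternating phi ->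
  ssum (subst a (A ++ (u ++ x :: y :: v) :: B) m) phi
  = - ssum (subst a (A ++ (u ++ y :: x :: v) :: B) m) phi.
Proof.
case: m => [|m1 ms]; first by rewrite !subst_nil oppr0.
move=> xy; elim: A phi => [|c A IHA] phi phiA; last first.
  have phiC := alternating_cons c phiA; rewrite !cat_cons.
  have [ac|ac] := boolP (a \in c); last by rewrite !subst_skip // IHA.
  have [u' [v' [-> au _]]] := first_occurrence ac.
  rewrite !subst_here // wpar_swap -sgN; congr (sg _ _).
  exact: shuf_alternatingl (alternating_cons _ phiA).
rewrite !cat0s.
have oppE (F G : seq (seq T) -> V) L : (forall r, F r = - G r) -> ssum L F = - ssum L G.
  move=> E; rewrite -[RHS]/(sg true _) -ssum_sg; exact: eq_ssum.
have [aU|aU] := boolP (a \in u).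
  have [u1 [u2 [-> au1 _]]] := first_occurrence aU; rewrite -!catA !cat_cons !subst_here //.
  have -> : odd (size (u2 ++ x :: y :: v)) = odd (size (u2 ++ y :: x :: v)) by rewrite !size_cat.
  rewrite -sgN; congr (sg _ _); apply: oppE => r.
  by have := phiA [::] (u1 ++ m1 ++ u2) v x y r; rewrite /= -!catA.
have here z : a != z -> ssum (subst a ((u ++ a :: z :: v) :: B) (m1 :: ms)) phi
    = - ssum (subst a ((u ++ z :: a :: v) :: B) (m1 :: ms)) phi.
  move=> az; have auz : a \notin rcons u z by rewrite mem_rcons inE negb_or az.
  rewrite -[u ++ z :: _]cat_rcons !subst_here //.
  rewrite -[RHS]/(sg true _) sg_sg.
  have E r : phi ((u ++ m1 ++ z :: v) :: r) =
      sg (odd (size m1)) (phi ((rcons u z ++ m1 ++ v) :: r)).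
    have := @alternating_swap _ _ _ u m1 [:: z] v r phiA; rewrite /= andbT => ->.
    by rewrite cat_rcons.
  rewrite (eq_ssum _ E) ssum_sg sg_sg; congr (sg _ _); parity.
have [ax|ax] := eqVneq a x; first by rewrite -ax here // ax.
have [ay|ay] := eqVneq a y; first by rewrite -ay here ?opprK // ay eq_sym.
have [av|av] := boolP (a \in v); last first.
  rewrite !subst_skip ?mem_cat ?inE ?negb_or ?aU ?ax ?ay //; apply: oppE => r.
  exact: (phiA [::]).
have [v1 [v2 [-> av1 _]]] := first_occurrence av.
have E p q : u ++ p :: q :: v1 ++ a :: v2 = (u ++ p :: q :: v1) ++ a :: v2 by rewrite -catA.
rewrite !E !subst_here ?mem_cat ?inE ?negb_or ?aU ?ax ?ay //.
rewrite -sgN; congr (sg _ _); apply: oppE => r.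
by have := phiA [::] u (v1 ++ m1 ++ v2) x y r; rewrite /= -!catA.
Qed.

Lemma subst_letter (a x : T) w phi : uniq (flatten w) -> a \in flatten w ->
  ssum (subst a w [:: [:: x]]) phi
  = phi (map (map (fun y => if y == a then x else y)) w).
Proof.
have mapE b : a \notin b -> map (fun y => if y == a then x else y) b = b.
  elim: b => [|y b IHb] //=; rewrite inE negb_or eq_sym => /andP[/negPf-> /IHb->] //.
elim: w phi => [|c w IHw] phi //=; rewrite cat_uniq mem_cat => /and3P[cU cw wU].
have [ac _|ac /= aw] := boolP (a \in c); last by rewrite ssum_map IHw ?mapE.
have aw : a \notin flatten w by apply: contraL ac => /(hasPn cw).
have [u [v [cE au iE]]] := first_occurrence ac.
have av : a \notin v by move: cU; rewrite cE cat_uniq /= => /and4P[_ _ ->].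
have -> : map (map (fun y => if y == a then x else y)) w = w.
  elim: (w) aw => [|b w' IHw'] //=; rewrite mem_cat negb_or => /andP[ab /IHw'->].
  by rewrite mapE.
have := subst_here v w [:: x] [::] phi au; rewrite /= -cE ac ssum_map => ->.
by rewrite shufs0 cE map_cat /= eqxx !mapE.
Qed.

Lemma subst_unit (a : T) m phi : m != [::] -> ssum (subst a [:: [:: a]] m) phi = phi m.
Proof.
case: m => // m1 ms _; have := @subst_here T V a [::] [::] [::] m1 ms phi isT.
by rewrite shuf0s cats0 andbF.
Qed.

Lemma perm_shuf s t r : r \in map snd (shuf s t) -> perm_eq r (s ++ t).
Proof.
elim: s t r => [|b s IHs] t r; first by rewrite inE => /eqP->.
elim: t r => [|c t IHt] r; first by rewrite inE => /eqP->; rewrite cats0.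
rewrite [shuf _ _]/= map_cat mem_cat => /orP[] /mem_smap[r' r'P ->] /=.
  by rewrite perm_cons IHs.
by rewrite -cat_cons perm_sym perm_catC /= perm_cons perm_catC perm_sym /= IHt.
Qed.

Lemma der_support w r : r \in map snd (der w) ->
  [/\ flatten r = flatten w, (size r).+1 = size w & [::] \notin w -> [::] \notin r].
Proof.
elim: w r => [|b s IHs] r //; rewrite [der _]/= => /mem_smap[{}r rP ->]; move: rP.
rewrite map_cat mem_cat => /orP[|/mem_smap[{}r /IHs[fE sE nE] ->]]; last first.
  split=> /=; rewrite ?fE ?sE // !inE !negb_or => /andP[-> /nE].
  by [].
case: s {IHs} => [|c s] //=; rewrite inE => /eqP->; split=> //=; first by rewrite catA.
by rewrite !inE; case: b => //= _ _ /norP[].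
Qed.

Lemma subst_support (a : T) w m r : r \in map snd (subst a w m) ->
  [/\ perm_eq (a :: flatten r) (flatten w ++ flatten m), ((size r).+1 = size w + size m)%N
    & [::] \notin w -> [::] \notin m -> [::] \notin r].
Proof.
elim: w r => [|c w IHw] r //=; case: ifP => [ac|_]; last first.
  move=> /mem_smap[{}r /IHw[pE sE nE] ->]; split=> /=.
  - by rewrite -cat1s perm_catCA -catA perm_cat2l.
  - by rewrite sE.
  - by rewrite !inE !negb_or => /andP[-> /nE].
case: m {IHw} => [|m1 ms] // /mem_smap[{}r /perm_shuf rP ->].
have [u [v [-> au ->]]] := first_occurrence ac.
rewrite take_size_cat // -cat_rcons drop_size_cat ?size_rcons // cat_rcons; split.
- apply/permP => p; have /permP/(_ p) := perm_flatten rP.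
  rewrite flatten_cat count_cat /= => E; rewrite /= !count_cat /= E; lia.
- by rewrite /= (perm_size rP) size_cat addnS.
- rewrite !inE !negb_or (perm_mem rP) mem_cat => /andP[_ /negPf->] /andP[mN /negPf->].
  by case: (u) => //; case: (m1) mN.
Qed.

End RawComplements.

(** * Relabelling of the letters *)

Section Relabelling.
Variables (S T : eqType) (V : zmodType) (f : S -> T).
Implicit Types (s t w : seq (seq S)) (phi : seq (seq T) -> V).

Lemma wpar_map w : wpar (map (map f) w) = wpar w.
Proof. by elim: w => //= b w ->; rewrite /bpar size_map. Qed.

Lemma shuf_map s t phi : ssum (shuf (map (map f) s) (map (map f) t)) phi
  = \ssum_(r <- shuf s t) phi (map (map f) r).
Proof.
elim: s t phi => [|b s IHs] t phi; first by rewrite /= !shuf0s.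
elim: t phi => [|c t IHt] phi; first by rewrite /= !ssum1.
rewrite !map_cons !shuf_cons -!map_cons IHs IHt; congr (_ + sg _ _).
by rewrite wpar_map /bpar size_map.
Qed.

Lemma der_map w phi : ssum (der (map (map f) w)) phi
  = \ssum_(r <- der w) phi (map (map f) r).
Proof.
elim: w phi => [|b w IHw] phi; first by rewrite /= !ssum_nil.
rewrite map_cons !der_cons IHw /bpar size_map !ssum_merge_head.
by congr (sg _ (_ + _)); case: (w) => [|c w'] //=; rewrite map_cat.
Qed.
End Relabelling.

Lemma subst_map (S T : eqType) (V : zmodType) (f : S -> T) (a : S) w m
    (phi : seq (seq T) -> V) : injective f ->
  ssum (subst (f a) (map (map f) w) (map (map f) m)) phi
  = \ssum_(r <- subst a w m) phi (map (map f) r).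
Proof.
move=> fI; case: m => [|m1 ms]; first by rewrite /= !subst_nil.
elim: w phi => [|c w IHw] phi; first by rewrite !ssum_nil.
have [ac|ac] := boolP (a \in c); last by rewrite map_cons !subst_skip ?mem_map // IHw.
have [u [v [-> au _]]] := first_occurrence ac.
rewrite !map_cons map_cat /= subst_here ?mem_map // (subst_here v w m1 ms _ au).
rewrite shuf_map wpar_map /bpar !size_map; congr (sg _ _).
by apply: eq_ssum => r; rewrite /= !map_cat.
Qed.

(*CUT*)
Local Open Scope quotient_scope.

(** * Additive maps defined on generators *)

Section Additive.
Variables (U V : zmodType) (F G : U -> V).
Hypothesis FD : {morph F : x y / x + y}.

Lemma morphD0 : F 0 = 0.
Proof. by apply: (addrI (F 0)); rewrite -FD !addr0. Qed.

Lemma morphDB : {morph F : x y / x - y}.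
Proof.
move=> x y; rewrite FD; congr (_ + _).
by apply: (addrI (F y)); rewrite -FD !subrr morphD0.
Qed.
Lemma morphBD (H : U -> V) : {morph H : x y / x - y} -> {morph H : x y / x + y}.
Proof.
move=> HB x y; rewrite -{1}[y]opprK -[- y]sub0r !HB -[X in H X - H y](subrr 0) HB subrr.
by rewrite sub0r opprK.
Qed.
End Additive.

Section PiTheory.
Variable I : finType.
Implicit Types (w : seq (seq I)) (e : expr I) (r s : {freeg (expr I) / int}).

Lemma clsB : {morph @cls I : r s / r - s}.
Proof. by move=> r s; rewrite /cls raddfB. Qed.

Lemma clsD : {morph @cls I : r s / r + s}.
Proof. by move=> r s; rewrite /cls raddfD. Qed.

Lemma cls_eq r s : cls r = cls s <-> antisym (r - s).
Proof.
rewrite /cls; split=> [E|E]; last first.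
  by apply/eqP; rewrite -Quotient.idealrBE; apply/asboolP.
by move/eqP: E; rewrite -Quotient.idealrBE => /asboolP.
Qed.

Lemma cls_repr (x : Pi I) : cls (repr x) = x.
Proof. exact: reprK. Qed.

Lemma gen_expr e : gen e = cls << e >>.
Proof. by rewrite /gen valK. Qed.

Lemma genE w (wE : is_expr w) : gen w = cls << Expr wE >>.
Proof. exact: (gen_expr (Expr wE)). Qed.

Lemma is_expr_swap A (u : seq I) x y v B :
  is_expr (A ++ (u ++ x :: y :: v) :: B) -> is_expr (A ++ (u ++ y :: x :: v) :: B).
Proof.
rewrite /is_expr => /andP[nE pE]; apply/andP; split.
  by move: nE; rewrite !mem_cat !inE; case: (u).
apply: perm_trans pE; rewrite !flatten_cat /= perm_cat2l -!catA perm_cat2l.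
by apply/permP => p /=; rewrite addnCA.
Qed.

Lemma gen_alternating : alternating (@gen I).
Proof.
move=> A u v x y B.
have [wE|wE] := boolP (is_expr (A ++ (u ++ x :: y :: v) :: B)).
  have wE' := is_expr_swap wE.
  apply/eqP; rewrite -addr_eq0 !genE -clsD; apply/eqP.
  rewrite -(morphD0 clsD); apply/cls_eq; rewrite subr0.
  exact: AntisymSwap.
have [wE'|wE'] := boolP (is_expr (A ++ (u ++ y :: x :: v) :: B)).
  by case/negP: wE; apply: is_expr_swap.
by rewrite /gen !insubN //= (morphD0 clsD) oppr0.
Qed.

(** Properties of all elements of Pi(I), or of a component of it, are proved by
    showing that they define a subgroup that contains the generators. *)
Definition zsubgroup (V : zmodType) (P : V -> Prop) :=
  P 0 /\ forall x y, P x -> P y -> P (x - y).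

Lemma cls_in_zsubgroup (P : Pi I -> Prop) r : zsubgroup P ->
  (forall e, e \in dom r -> P (gen e)) -> P (cls r).
Proof.
move=> [P0 PB] H.
have PN y : P y -> P (- y) by move=> Py; rewrite -[- y]sub0r; apply: PB.
have PD x y : P x -> P y -> P (x + y).
  by move=> Px Py; rewrite -[y]opprK; apply: PB => //; apply: PN.
have PM n x : P x -> P (x *+ n).
  by move=> Px; elim: n => [|n IHn]; rewrite ?mulr0n // mulrS; apply: PD.
rewrite -[r]freeg_sumE; elim: (dom r) H => [|e s IHs] H.
  by rewrite big_nil (morphD0 clsD).
rewrite big_cons clsD; apply: PD; last by apply: IHs => e' es; apply: H; rewrite inE es orbT.
have Pe : P (gen e) by apply: H; rewrite mem_head.
have -> : cls << coeff e r *g e >> = gen e *~ coeff e r.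
  by rewrite gen_expr -{1}[coeff e r]intz -freegU_mulz /cls raddfMz.
by case: (coeff e r) => n; rewrite ?NegzE ?mulrNz -?pmulrn; [|apply: PN]; apply: PM.
Qed.

Lemma Pi_gr_ind n (P : Pi I -> Prop) : zsubgroup P ->
  (forall w, is_expr w -> (dims w)%:Z = n -> P (gen w)) -> forall x, Pi_gr n x -> P x.
Proof.
move=> PZ H x [r rn ->]; apply: cls_in_zsubgroup => // e /rn en; exact: H (valP e) en.
Qed.

Lemma Pi_ind (P : Pi I -> Prop) : zsubgroup P ->
  (forall w, is_expr w -> P (gen w)) -> forall x, P x.
Proof.
move=> PZ H x; rewrite -[x]cls_repr; apply: cls_in_zsubgroup => // e _; exact: H (valP e).
Qed.

Lemma zsubgroup_eq (U V : zmodType) (F G : U -> V) :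
  {morph F : x y / x + y} -> {morph G : x y / x + y} -> zsubgroup (fun x => F x = G x).
Proof.
move=> FD GD; split=> [|x y E E']; first by rewrite !morphD0.
by rewrite !morphDB // E E'.
Qed.

Lemma Pi_morph_ext (V : zmodType) (F G : Pi I -> V) :
  {morph F : x y / x + y} -> {morph G : x y / x + y} ->
  (forall w, is_expr w -> F (gen w) = G (gen w)) -> F =1 G.
Proof. by move=> FD GD; apply: Pi_ind; apply: zsubgroup_eq. Qed.

Lemma zsubgroup_Pi_gr n : zsubgroup (@Pi_gr I n).
Proof.
split; first by exists 0 => [e|]; rewrite ?dom0 // (morphD0 clsD).
move=> _ _ [r rn ->] [s sn ->]; exists (r - s); last by rewrite clsB.
by move=> e /domB; rewrite mem_cat => /orP[/rn|/sn].
Qed.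

Lemma Pi_gr_gen w : is_expr w -> Pi_gr (dims w)%:Z (gen w).
Proof.
by move=> wE; exists << Expr wE >>; rewrite ?genE // => e; rewrite domU1 inE => /eqP->.
Qed.

Section Extension.
Variable V : zmodType.
Implicit Type phi : seq (seq I) -> V.

Definition alternating_on_expr phi := forall A (u v : seq I) x y B,
  is_expr (A ++ (u ++ x :: y :: v) :: B) ->
  phi (A ++ (u ++ x :: y :: v) :: B) = - phi (A ++ (u ++ y :: x :: v) :: B).

Definition extend_free phi : {freeg (expr I) / int} -> zmodule V :=
  fglift (fun e : expr I => phi e : zmodule V).

(** The value is that of the linear extension of phi at a representative; it does
    not depend on the representative when phi is alternating ([extend_cls]). *)
Definition extend phi (x : Pi I) : V := extend_free phi (repr x).

Lemma extend_freeB phi : {morph extend_free phi : r s / r - s}.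
Proof. exact: lift_is_additive. Qed.

Variable phi : seq (seq I) -> V.
Hypothesis phiA : alternating_on_expr phi.

Lemma extend_cls r : extend phi (cls r) = extend_free phi r.
Proof.
have /cls_eq := cls_repr (cls r); rewrite /extend.
set s := repr _ => srA; apply/eqP; rewrite -subr_eq0; apply/eqP.
have FD := morphBD (extend_freeB phi).
rewrite -[LHS]/(extend_free phi s - extend_free phi r) -extend_freeB.
elim: {s} (s - r) / srA => [|s t _ IHs _ IHt|e e' A u x y v B eE eE'].
- exact: morphD0 FD.
- by rewrite extend_freeB IHs IHt subrr.
rewrite FD /extend_free !liftU !scale1r /=; apply/eqP; rewrite addr_eq0; apply/eqP.
by rewrite eE eE'; apply: phiA; rewrite -eE; apply: valP.
Qed.

Lemma extend_gen w : is_expr w -> extend phi (gen w) = phi w.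
Proof. by move=> wE; rewrite genE extend_cls /extend_free liftU scale1r. Qed.

Lemma extendD : {morph extend phi : x y / x + y}.
Proof.
move=> x y; rewrite -[x]cls_repr -[y]cls_repr -clsD !extend_cls.
exact: (morphBD (extend_freeB phi)).
Qed.
End Extension.
End PiTheory.

(*CUT*)

(** * Expressions with letters in an ambient set *)

Definition nf_point (S : nefin) : S := enum_val (Ordinal (nf_ne S)).

Section Ambient.
Variables (S : nefin) (T : eqType) (e : S -> T).
Implicit Types (w : seq (seq S)) (r : seq (seq T)).

Definition retraction (t : T) : S := odflt (nf_point S) [pick s | e s == t].

(** The element of Pi(S) given by a word in T, when all letters of this word are in
    the image of S. It is defined for all words in T, so as to be an alternating
    function in the sense above. *)
Definition place r : Pi S := gen (map (map retraction) r).

Definition expr_on r := exists2 w, is_expr w & r = map (map e) w.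

Lemma place_alternating : alternating place.
Proof. by move=> A u v x y B; rewrite /place !map_cat /= !map_cat /= gen_alternating. Qed.

Hypothesis eI : injective e.

Lemma retractionK : cancel e retraction.
Proof.
move=> s; rewrite /retraction; case: pickP => [s' /eqP/eI//|/(_ s)]; by rewrite eqxx.
Qed.

Lemma map_retractionK w : map (map retraction) (map (map e) w) = w.
Proof. by apply: mapK; apply: mapK; apply: retractionK. Qed.

Lemma place_map w : place (map (map e) w) = gen w.
Proof. by rewrite /place map_retractionK. Qed.

Lemma expr_onP r :
  expr_on r <-> [/\ [::] \notin r, uniq (flatten r)
                 & forall t, t \in flatten r <-> exists s, t = e s].
Proof.
split=> [[w /is_exprP[wN wU wM] ->]|[rN rU rM]].
  rewrite nil_map -map_flatten map_inj_uniq //; split=> // t.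
  by split=> [/mapP[s _ ->]|[s ->]]; [exists s | rewrite map_f].
have rE : r = map (map e) (map (map retraction) r).
  have K t : t \in flatten r -> e (retraction t) = t.
    by move=> /rM[s ->]; rewrite retractionK.
  elim: (r) K => [|b r' IHr] K //=; rewrite -IHr => [|t tr]; last first.
    by apply: K; rewrite /= mem_cat tr orbT.
  congr (_ :: _); rewrite -map_comp map_id_in // => t tb /=.
  by apply: K; rewrite /= mem_cat tb.
exists (map (map retraction) r) => //; apply/is_exprP; split.
- by rewrite nil_map.
- by move: rU; rewrite {1}rE -map_flatten map_inj_uniq.
- move=> s; have /rM : exists s', e s = e s' by exists s.
  by rewrite {1}rE -map_flatten mem_map.
Qed.

Lemma der_expr_on r t : expr_on r -> t \in map snd (der r) -> expr_on t.
Proof.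
move=> /expr_onP[rN rU rM] /der_support[tE _ tN]; apply/expr_onP.
by rewrite tE; split=> //; apply: tN.
Qed.
End Ambient.

Lemma expr_on_id (S : nefin) (w : seq (seq S)) : is_expr w <-> expr_on id w.
Proof.
have mapE (v : seq (seq S)) : map (map id) v = v by rewrite (eq_map (@map_id _)) map_id.
by split=> [wE|[v vE ->]]; [exists w; rewrite ?mapE | rewrite mapE].
Qed.

Section Embedding.
Variables (I J : nefin) (T : eqType) (e : I -> T) (g : J -> T) (i : I).

Definition emb (z : ins i J) : T := match z with inl x => e (val x) | inr y => g y end.

Hypotheses (eI : injective e) (gI : injective g) (eg : forall x y, e x != g y).

Lemma emb_inj : injective emb.
Proof.
move=> [x|y] [x'|y'] //= E.
- by congr inl; apply: val_inj; apply: eI.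
- by have := eg (val x) y'; rewrite E eqxx.
- by have := eg (val x') y; rewrite E eqxx.
- by congr inr; apply: gI.
Qed.

(** The letters of the result are those of t and n, each once, except for e(i). *)
Lemma subst_expr_on t n r : expr_on e t -> expr_on g n ->
  r \in map snd (subst (e i) t n) -> expr_on emb r.
Proof.
move=> /(expr_onP eI)[tN tU tM] /(expr_onP gI)[nN nU nM] /subst_support[rE _ rN].
have : uniq (e i :: flatten r).
  rewrite (perm_uniq rE) cat_uniq tU nU andbT; apply/hasPn => _ /nM[y ->].
  by apply/negP => /tM[x /eqP]; rewrite eq_sym (negPf (eg x y)).
rewrite cons_uniq => /andP[eir rU].
apply/(expr_onP emb_inj); split; [exact: rN | exact: rU |].
have rM z : (z == e i) || (z \in flatten r) = (z \in flatten t) || (z \in flatten n).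
  by have := perm_mem rE z; rewrite inE mem_cat.
move=> z; split=> [zr|[[x|y] ->] /=].
- have := rM z; rewrite zr orbT => /esym/orP[/tM[x zx]|/nM[y zy]]; last by exists (inr y).
  have xi : x != i by apply: contraNneq eir => xi; rewrite -xi -zx.
  by exists (inl (exist _ x xi)).
- have et : e (val x) \in flatten t by apply/tM; exists (val x).
  by have := rM (e (val x)); rewrite et (inj_eq eI) (negPf (valP x)).
- have gn : g y \in flatten n by apply/nM; exists y.
  by have := rM (g y); rewrite gn orbT eq_sym (negPf (eg i y)).
Qed.
End Embedding.

(** * The structure maps *)

Section StructureMaps.

Definition Pi_d (I : nefin) : Pi I -> Pi I := extend (fun w => ssum (der w) (@gen I)).

Definition Pi_act (I J : nefin) (f : I -> J) : Pi I -> Pi J :=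
  extend (fun w => gen (map (map f) w)).

(** The substitution is performed on words in I |_| J, which contains the letter i
    that disappears as well as the letters of the result. *)
Definition comp_words (I : nefin) (i : I) (J : nefin) (w : seq (seq I)) (m : seq (seq J)) :
    Pi (ins i J) :=
  ssum (subst (inl i : I + J) (map (map inl) w) (map (map inr) m)) (place (emb inl inr (i := i))).

Definition Pi_comp (I : nefin) (i : I) (J : nefin) (x : Pi I) (y : Pi J) : Pi (ins i J) :=
  extend (fun w => extend (comp_words i w) y) x.

Lemma d_alternating (I : nefin) : alternating_on_expr (fun w => ssum (der w) (@gen I)).
Proof. by move=> A u v x y B _; apply: der_alternating; apply: gen_alternating. Qed.

Lemma act_alternating (I J : nefin) (f : I -> J) :
  alternating_on_expr (fun w => gen (map (map f) w)).
Proof. by move=> A u v x y B _; rewrite !map_cat /= !map_cat /= gen_alternating. Qed.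

Lemma comp_alternatingr (I : nefin) (i : I) (J : nefin) w :
  alternating_on_expr (@comp_words I i J w).
Proof.
move=> A u v x y B _; rewrite /comp_words !map_cat /= !map_cat /= subst_alternatingr //.
exact: (@place_alternating (ins i J)).
Qed.

Lemma comp_alternatingl (I : nefin) (i : I) (J : nefin) y :
  alternating_on_expr (fun w => extend (@comp_words I i J w) y).
Proof.
move=> A u v x x' B wE.
have xx' : x != x'.
  move: wE => /is_exprP[_ wU _]; move: wU; rewrite flatten_cat cat_uniq /= => /and3P[_ _].
  rewrite -catA cat_uniq => /and3P[_ _] /=; rewrite inE negb_or => /andP[/andP[]] //.
have nD (F : Pi J -> Pi (ins i J)) :
    {morph F : x y / x + y} -> {morph (fun y => - F y) : x y / x + y}.
  by move=> FD z z'; rewrite FD opprD.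
move: y; apply: Pi_morph_ext.
- exact: extendD (@comp_alternatingr _ _ _ _).
- apply: nD; exact: extendD (@comp_alternatingr _ _ _ _).
move=> m mE; rewrite !extend_gen //; try exact: comp_alternatingr.
rewrite /comp_words !map_cat /= !map_cat /= subst_alternatingl //.
  exact: (@place_alternating (ins i J)).
Qed.

Lemma Pi_dD (I : nefin) : {morph @Pi_d I : x y / x + y}.
Proof. exact: extendD (@d_alternating I). Qed.

Lemma Pi_actD (I J : nefin) (f : I -> J) : {morph Pi_act f : x y / x + y}.
Proof. exact: extendD (@act_alternating I J f). Qed.

Lemma Pi_compDl (I : nefin) (i : I) (J : nefin) (y : Pi J) :
  {morph (fun x => Pi_comp i x y) : x x' / x + x'}.
Proof. exact: extendD (@comp_alternatingl I i J y). Qed.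

Lemma Pi_compDr (I : nefin) (i : I) (J : nefin) (x : Pi I) :
  {morph (fun y : Pi J => Pi_comp i x y) : y y' / y + y'}.
Proof.
move=> y y'; move: x; apply: Pi_morph_ext; first exact: Pi_compDl.
  by move=> x x'; rewrite !(Pi_compDl i _ x x') addrACA.
move=> w wE; rewrite /Pi_comp !extend_gen //; try exact: comp_alternatingl.
exact: extendD (@comp_alternatingr _ _ _ _) _ _.
Qed.

Lemma Pi_d_gen (I : nefin) (w : seq (seq I)) : is_expr w -> Pi_d (gen w) = ssum (der w) (@gen I).
Proof. exact: extend_gen (@d_alternating I) _. Qed.

Lemma Pi_act_gen (I J : nefin) (f : I -> J) w :
  is_expr w -> Pi_act f (gen w) = gen (map (map f) w).
Proof. exact: extend_gen (@act_alternating I J f) _. Qed.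

Lemma Pi_comp_gen (I : nefin) (i : I) (J : nefin) (w : seq (seq I)) (m : seq (seq J)) :
  is_expr w -> is_expr m -> Pi_comp i (gen w) (gen m) = comp_words i w m.
Proof.
move=> wE mE; rewrite /Pi_comp extend_gen //; last exact: comp_alternatingl.
by rewrite extend_gen //; apply: comp_alternatingr.
Qed.

Lemma Pi_d_place (S : nefin) (T : eqType) (e : S -> T) r : injective e -> expr_on e r ->
  Pi_d (place e r) = ssum (der r) (place e).
Proof.
move=> eI [w wE ->]; rewrite place_map // Pi_d_gen // der_map.
by apply: eq_ssum => r'; rewrite place_map.
Qed.

(** A bijection between two subsets of T is invisible on words in T when it is
    compatible with the embeddings. *)
Lemma Pi_act_place (S S' : nefin) (f : S -> S') (T : eqType) (e : S -> T) (e' : S' -> T) r :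
  injective e -> injective e' -> (forall s, e s = e' (f s)) -> expr_on e r ->
  Pi_act f (place e r) = place e' r.
Proof.
move=> eI e'I ef [w wE ->]; rewrite place_map // Pi_act_gen //.
rewrite -(place_map e'I) -map_comp; congr (place e' _); apply: eq_map => b /=.
by rewrite -map_comp; apply: eq_map => s /=; rewrite ef.
Qed.

(** The composition is defined by a substitution in I |_| J; the embeddings e and g
    of I and J define an injection of this set into T, along which it can be
    transported. *)
Lemma Pi_comp_place (I J : nefin) (i : I) (T : eqType) (e : I -> T) (g : J -> T) t n :
  injective e -> injective g -> (forall x y, e x != g y) ->
  expr_on e t -> expr_on g n ->
  Pi_comp i (place e t) (place g n) = ssum (subst (e i) t n) (place (emb e g (i := i))).
Proof.
move=> eI gI eg [w wE ->] [m mE ->]; rewrite !place_map // Pi_comp_gen // /comp_words.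
pose h (z : I + J) := match z with inl x => e x | inr y => g y end.
have hI : injective h.
  move=> [x|y] [x'|y'] /= E; [congr inl | | | congr inr].
  - exact: eI.
  - by have := eg x y'; rewrite E eqxx.
  - by have := eg x' y; rewrite E eqxx.
  - exact: gI.
have hE (K : Type) (k : K -> I + J) (v : seq (seq K)) :
    map (map h) (map (map k) v) = map (map (h \o k)) v.
  by rewrite -map_comp; apply: eq_map => b /=; rewrite -map_comp.
have -> : ssum (subst (e i) (map (map e) w) (map (map g) m)) (place (emb e g (i := i)))
   = ssum (subst (h (inl i)) (map (map h) (map (map inl) w)) (map (map h) (map (map inr) m)))
       (place (emb e g (i := i))).
  by rewrite !hE.
rewrite subst_map //; apply: eq_in_ssum => r.
have inlI : injective (@inl I J) by move=> ? ? [].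
have inrI : injective (@inr I J) by move=> ? ? [].
have Ew : expr_on inl (map (map (@inl I J)) w) by exists w.
have Em : expr_on inr (map (map (@inr I J)) m) by exists m.
move=> /(subst_expr_on inlI inrI _ Ew Em)[|z zE ->] //.
rewrite place_map; last exact: emb_inj.
rewrite hE.
have -> : map (map (h \o emb inl inr (i := i))) z = map (map (emb e g (i := i))) z.
  by apply: eq_map => b; apply: eq_map => -[].
by rewrite place_map //; apply: emb_inj.
Qed.

End StructureMaps.

(*CUT*)

(** * The complexes Pi(I) *)

Lemma ssum_in_zsubgroup (T : eqType) (V : zmodType) (P : V -> Prop) (L : seq (bool * T)) phi :
  zsubgroup P -> (forall t, t \in map snd L -> P (phi t)) -> P (ssum L phi).
Proof.
move=> [P0 PB]; have PN y : P y -> P (- y) by move=> Py; rewrite -[- y]sub0r; apply: PB.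
rewrite /ssum; elim: L => [|[b t] L IHL] H; first by rewrite big_nil.
rewrite big_cons -[X in _ + X]opprK; apply: PB.
  have Pt : P (phi t) by apply: H; rewrite mem_head.
  by case: (b) => /=; [apply: PN|].
by apply: PN; apply: IHL => t' t'L; apply: H; rewrite inE t'L orbT.
Qed.

Section Dims.
Variable T : eqType.
Implicit Type w : seq (seq T).

Lemma dims_cons (b : seq T) w : dims (b :: w) = (Defs.dim b + dims w)%N.
Proof. exact: big_cons. Qed.

(** This relation gives the effect of the structure maps on degrees, as it is easy
    to follow the number of blocks and the number of letters. *)
Lemma dims_size w : [::] \notin w -> (dims w + size w = size (flatten w))%N.
Proof.
elim: w => [|b w IHw]; first by rewrite /dims big_nil.
rewrite inE negb_or => /andP[bN wN]; rewrite dims_cons /= size_cat -IHw // /Defs.dim.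
by case: b bN => //= x b _; lia.
Qed.

Lemma odd_dim (b : seq T) : b != [::] -> odd (Defs.dim b) = bpar b.
Proof. by case: b => //= x b _; rewrite /bpar /= negbK. Qed.

Lemma odd_dims w : [::] \notin w -> odd (dims w) = wpar w.
Proof.
elim: w => [|b w IHw]; first by rewrite /dims big_nil.
rewrite inE negb_or eq_sym => /andP[bN wN]; by rewrite dims_cons oddD IHw // odd_dim.
Qed.

Lemma dims_map (S : Type) (e : T -> S) w : dims (map (map e) w) = dims w.
Proof.
rewrite /dims big_map; apply: eq_bigr => b _; by rewrite /Defs.dim size_map.
Qed.

Lemma dims_der w r : [::] \notin w -> r \in map snd (der w) -> dims r = (dims w).+1.
Proof.
move=> wN /der_support[rE rS rN]; have := dims_size wN; have := dims_size (rN wN).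
by rewrite rE -rS; lia.
Qed.

Lemma dims_subst (a : T) w m r : [::] \notin w -> [::] \notin m ->
  r \in map snd (subst a w m) -> dims r = (dims w + dims m)%N.
Proof.
move=> wN mN /subst_support[rE rS rN]; have := dims_size wN; have := dims_size mN.
have := dims_size (rN wN mN); have /= := perm_size rE; rewrite size_cat; lia.
Qed.

Lemma dims_swap A (u : seq T) x y v B :
  dims (A ++ (u ++ x :: y :: v) :: B) = dims (A ++ (u ++ y :: x :: v) :: B).
Proof. by rewrite /dims !big_cat !big_cons /Defs.dim !size_cat. Qed.
End Dims.

Lemma is_expr_nil (I : finType) (w : seq (seq I)) : is_expr w -> [::] \notin w.
Proof. by case/andP. Qed.

Section Complex.
Variable I : nefin.
Implicit Types w : seq (seq I).

Lemma der_is_expr w r : is_expr w -> r \in map snd (der w) -> is_expr r.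
Proof. by move=> /expr_on_id wE rw; apply/expr_on_id; apply: der_expr_on rw. Qed.

(** The projection onto the component of degree n, which shows that Pi(I) is the
    direct sum of its components. *)
Definition Pi_proj (n : int) : Pi I -> Pi I :=
  extend (fun w => if (dims w)%:Z == n then gen w else 0).

Lemma proj_alternating n :
  alternating_on_expr (fun w : seq (seq I) => if (dims w)%:Z == n then gen w else 0).
Proof.
by move=> A u v x y B _; rewrite dims_swap; case: ifP; rewrite ?oppr0 // gen_alternating.
Qed.

Lemma Pi_projD n : {morph Pi_proj n : x y / x + y}.
Proof. exact: extendD (@proj_alternating n). Qed.

Lemma Pi_proj_gr m n x : Pi_gr m x -> Pi_proj n x = if m == n then x else 0.
Proof.
move: x; apply: Pi_gr_ind.
  apply: zsubgroup_eq; first exact: Pi_projD.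
  by case: eqP => // _ y z; rewrite addr0.
by move=> w wE <-; apply: extend_gen wE; apply: proj_alternating.
Qed.

Lemma Pi_proj_is_gr n x : Pi_gr n (Pi_proj n x).
Proof.
move: x; apply: Pi_ind => [|w wE].
  have [P0 PB] := zsubgroup_Pi_gr I n.
  split=> [|x y Px Py]; first by rewrite (morphD0 (@Pi_projD n)).
  by rewrite (morphDB (@Pi_projD n)); apply: PB.
rewrite /Pi_proj extend_gen //; last exact: proj_alternating.
case: eqP => [<-|_]; first exact: Pi_gr_gen.
by have [] := zsubgroup_Pi_gr I n.
Qed.

(** The degrees of expressions are bounded by the number of letters. *)
Lemma Pi_proj_sum x : x = \sum_(n <- map Posz (iota 0 #|I|.+1)) Pi_proj n x.
Proof.
move: x; apply: Pi_morph_ext => // [x y|w wE].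
  by rewrite -big_split; apply: eq_bigr => n _; apply: Pi_projD.
rewrite big_map (bigD1_seq (dims w)) ?iota_uniq //; last first.
  have := dims_size (is_expr_nil wE); rewrite mem_iota /=.
  case/andP: wE => _ /perm_size ->; rewrite -cardE => E; by rewrite add0n ltnS -E leq_addr.
rewrite /= (Pi_proj_gr _ (Pi_gr_gen wE)) eqxx big1 /= ?addr0 // => n nw.
by rewrite (Pi_proj_gr _ (Pi_gr_gen wE)) eqz_nat eq_sym (negPf nw).
Qed.

Lemma Pi_complex : is_complex (CxData (@Pi_gr I) (@Pi_d I)).
Proof.
have grZ n := zsubgroup_Pi_gr I n.
split=> /=.
- by move=> n; have [] := grZ n.
- by move=> n; have [_] := grZ n.
- move=> x; exists (map Posz (iota 0 #|I|.+1)), (fun n => Pi_proj n x).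
  by split; [move=> n; apply: Pi_proj_is_gr | apply: Pi_proj_sum].
- move=> s c sU cG cE n ns; have := congr1 (Pi_proj n) cE.
  rewrite (morphD0 (@Pi_projD n)) (big_morph _ (@Pi_projD n) (morphD0 (@Pi_projD n))).
  rewrite (bigD1_seq n) //= (Pi_proj_gr _ (cG n)) eqxx big1 ?addr0 // => m mn.
  by rewrite (Pi_proj_gr _ (cG m)) (negPf mn).
- exact: Pi_dD.
- move=> n; apply: Pi_gr_ind => [|w wE <-].
    have [P0 PB] := grZ (n + 1).
    split=> [|y z Py Pz]; first by rewrite (morphD0 (@Pi_dD I)).
    by rewrite (morphDB (@Pi_dD I)); apply: PB.
  rewrite Pi_d_gen //; apply: ssum_in_zsubgroup => // r rw.
  rewrite -PoszD addn1 -(dims_der (is_expr_nil wE) rw).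
  by apply: Pi_gr_gen; apply: der_is_expr rw.
- apply: Pi_morph_ext => [x y|x y|w wE]; first by rewrite !Pi_dD.
    by rewrite addr0.
  rewrite Pi_d_gen // (additive_ssum _ _ (@Pi_dD I)).
  rewrite -[RHS](der_der w (@gen I)); apply: eq_in_ssum => r rw.
  by rewrite Pi_d_gen //; apply: der_is_expr rw.
Qed.
End Complex.

(** * The axioms of operads *)

Section Action.

Lemma Pi_act_chain (I J : nefin) (f : bij I J) :
  @is_chain_map (CxData (@Pi_gr I) (@Pi_d I)) (CxData (@Pi_gr J) (@Pi_d J)) (Pi_act f).
Proof.
split=> /= [|n|]; first exact: Pi_actD.
  apply: Pi_gr_ind => [|w wE <-].
    have [P0 PB] := zsubgroup_Pi_gr J n.
    split=> [|y z Py Pz]; first by rewrite (morphD0 (Pi_actD f)).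
    by rewrite (morphDB (Pi_actD f)); apply: PB.
  rewrite Pi_act_gen // -(dims_map f); apply: Pi_gr_gen; exact: is_expr_relabel.
apply: Pi_morph_ext => [x y|x y|w wE]; try by rewrite !(Pi_actD f, Pi_dD).
rewrite Pi_act_gen // !Pi_d_gen //; last exact: is_expr_relabel.
rewrite der_map (additive_ssum _ _ (Pi_actD f)); apply: eq_in_ssum => r rw.
by rewrite Pi_act_gen //; apply: der_is_expr rw.
Qed.

Lemma Pi_act_ext (I J : nefin) (f g : bij I J) : f =1 g -> Pi_act f =1 Pi_act g.
Proof.
move=> fg; apply: Pi_morph_ext; try exact: Pi_actD.
by move=> w wE; rewrite !Pi_act_gen //; congr gen; apply: eq_map => b; apply: eq_map.
Qed.

Lemma Pi_act_id (I : nefin) (x : Pi I) : Pi_act (bij_id I) x = x.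
Proof.
move: x; apply: Pi_morph_ext => // [|w wE]; first exact: Pi_actD.
rewrite Pi_act_gen //; congr gen; rewrite -[RHS]map_id; apply: eq_map => b; exact: map_id.
Qed.

Lemma Pi_act_comp (I J K : nefin) (g : bij J K) (f : bij I J) (x : Pi I) :
  Pi_act (Defs.bij_comp g f) x = Pi_act g (Pi_act f x).
Proof.
move: x; apply: Pi_morph_ext => [||w wE]; first exact: Pi_actD.
  by move=> x y; rewrite !Pi_actD.
rewrite !Pi_act_gen //; last exact: is_expr_relabel.
by congr gen; rewrite -map_comp; apply: eq_map => b /=; rewrite -map_comp.
Qed.
End Action.

(*CUT*)
Lemma inl_inj (A B : Type) : injective (@inl A B).
Proof. by move=> x y []. Qed.

Lemma inr_inj (A B : Type) : injective (@inr A B).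
Proof. by move=> x y []. Qed.

Lemma expr_on_map (S : nefin) (T : eqType) (e : S -> T) (w : seq (seq S)) :
  is_expr w -> expr_on e (map (map e) w).
Proof. by exists w. Qed.

Lemma expr_on_nil (S : nefin) (T : eqType) (e : S -> T) r : expr_on e r -> [::] \notin r.
Proof. by move=> [w /is_expr_nil wN ->]; rewrite nil_map. Qed.

Lemma place_gr (S : nefin) (T : eqType) (e : S -> T) r :
  injective e -> expr_on e r -> Pi_gr (dims r)%:Z (place e r).
Proof. by move=> eI [w wE ->]; rewrite place_map // dims_map; apply: Pi_gr_gen. Qed.

Section Composition.
Variables (I J : nefin) (i : I).

Let e : I -> I + J := inl.
Let g : J -> I + J := inr.

Let eI : injective e. Proof. exact: inl_inj. Qed.
Let gI : injective g. Proof. exact: inr_inj. Qed.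
Let eg x y : e x != g y. Proof. by []. Qed.

Lemma Pi_comp_tensor : @is_tensor_map (CxData (@Pi_gr I) (@Pi_d I)) (CxData (@Pi_gr J) (@Pi_d J))
  (CxData (@Pi_gr (ins i J)) (@Pi_d (ins i J))) (@Pi_comp I i J).
Proof.
split=> /= [x x' y|x y y'|m n x y|m x y].
- exact: Pi_compDl.
- exact: Pi_compDr.
- have [Q0 QB] := zsubgroup_Pi_gr (ins i J) (m + n).
  move=> xm; move: y; apply: Pi_gr_ind => [|v vE <-].
    split=> [|y y' Hy Hy']; first by rewrite (morphD0 (Pi_compDr i x)).
    by rewrite (morphDB (Pi_compDr i x)); apply: QB.
  move: x xm; apply: Pi_gr_ind => [|w wE <-].
    split=> [|y y' Hy Hy'].
      by rewrite (morphD0 (Pi_compDl i (gen v))); apply: (zsubgroup_Pi_gr _ _).1.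
    by rewrite (morphDB (Pi_compDl i (gen v))); apply: (zsubgroup_Pi_gr _ _).2.
  have Ew := expr_on_map e wE; have Ev := expr_on_map g vE.
  rewrite -(place_map eI) -(place_map gI) Pi_comp_place //.
  apply: ssum_in_zsubgroup => [|r rS]; first exact: zsubgroup_Pi_gr.
  rewrite -PoszD -(dims_map e w) -(dims_map g v).
  rewrite -(dims_subst (expr_on_nil Ew) (expr_on_nil Ev) rS).
  by apply: (@place_gr (ins i J)); [apply: emb_inj | apply: subst_expr_on rS].
move=> xm; rewrite sgEz; move: y; apply: Pi_morph_ext => [y y'|y y'|v vE].
- by rewrite Pi_compDr Pi_dD.
- by rewrite Pi_dD !Pi_compDr sgD addrACA.
move: x xm; apply: Pi_gr_ind => [|w wE <-].
  apply: zsubgroup_eq => x y; first by rewrite Pi_compDl Pi_dD.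
  by rewrite Pi_dD !Pi_compDl sgD addrACA.
have Ew := expr_on_map e wE; have Ev := expr_on_map g vE.
rewrite -(place_map eI) -(place_map gI).
set W := map _ w in Ew *; set M := map _ v in Ev *.
have -> : odd `|dims w| = wpar W by rewrite absz_nat -(odd_dims (expr_on_nil Ew)) dims_map.
rewrite Pi_comp_place // (additive_ssum _ _ (@Pi_dD _)).
have dE r : r \in map snd (subst (e i) W M) ->
    Pi_d (place (emb e g (i := i)) r) = ssum (der r) (place (emb e g (i := i))).
  by move=> rS; apply: Pi_d_place; [apply: emb_inj | apply: subst_expr_on rS].
rewrite (eq_in_ssum dE) der_subst; last exact: (@place_alternating (ins i J)).
rewrite !Pi_d_place // (additive_ssum _ _ (@Pi_compDl I i J (place g M))).
rewrite (additive_ssum _ _ (@Pi_compDr I i J (place e W))).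
congr (_ + sg _ _); apply: eq_in_ssum => r rD; rewrite Pi_comp_place //.
- exact: der_expr_on rD.
- exact: der_expr_on rD.
Qed.

End Composition.

Section Equivariance.

Lemma Pi_comp_act (I I' J J' : nefin) (f : bij I I') (g : bij J J') (i : I)
    (x : Pi I) (y : Pi J) :
  Pi_comp (f i) (Pi_act f x) (Pi_act g y) = Pi_act (ins_map f g i) (Pi_comp i x y).
Proof.
move: x; apply: Pi_morph_ext => [x x'|x x'|w wE]; try by rewrite ?Pi_actD ?Pi_compDl ?Pi_actD.
move: y; apply: Pi_morph_ext => [y y'|y y'|v vE]; try by rewrite ?Pi_actD ?Pi_compDr ?Pi_actD.
have fI := bij_inj (bij_bij f); have gI := bij_inj (bij_bij g).
pose e x : I' + J' := inl (f x); pose h y : I' + J' := inr (g y).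
have eI : injective e by move=> x y [E]; apply: fI.
have hI : injective h by move=> x y [E]; apply: gI.
have Ew := expr_on_map e wE; have Ev := expr_on_map h vE.
have Ew' : expr_on inl (map (map e) w).
  exists (map (map f) w); first exact: is_expr_relabel.
  by rewrite -map_comp; apply: eq_map => b /=; rewrite -map_comp.
have Ev' : expr_on inr (map (map h) v).
  exists (map (map g) v); first exact: is_expr_relabel.
  by rewrite -map_comp; apply: eq_map => b /=; rewrite -map_comp.
rewrite -(place_map eI) -(place_map hI) (@Pi_act_place _ _ _ _ e inl) //; last exact: inl_inj.
rewrite (@Pi_act_place _ _ _ _ h inr) //; last exact: inr_inj.
rewrite !Pi_comp_place //; try exact: inl_inj; try exact: inr_inj.
rewrite (additive_ssum _ _ (Pi_actD _)); apply: eq_in_ssum => r rS.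
rewrite (@Pi_act_place _ _ _ _ (emb e h (i := i)) (emb inl inr (i := f i))) //.
- exact: emb_inj.
- apply: emb_inj => //; [exact: inl_inj | exact: inr_inj].
- by case.
- exact: subst_expr_on rS.
Qed.

Lemma Pi_compx1 (I : nefin) (i : I) (x : Pi I) :
  Pi_act (runit i) (Pi_comp i x (gen [:: [:: tt]] : Pi pt)) = x.
Proof.
move: x; apply: Pi_morph_ext => // [x x'|w wE]; first by rewrite Pi_compDl Pi_actD.
pose e x : I + pt := inl x; pose h (y : pt) : I + pt := inr y.
(* The result of the substitution is w, up to the name of the letter i. *)
pose e' x : I + pt := if x == i then inr tt else inl x.
have e'I : injective e'.
  by move=> x y; rewrite /e'; case: eqP => [->|_]; case: eqP => [->|_] // [].
have Ew := expr_on_map e wE; have Eu := expr_on_map h is_expr_pt.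
have [_ wU wM] := is_exprP _ wE.
have eE : injective e by exact: inl_inj.
have hE : injective h by exact: inr_inj.
rewrite -[in LHS](place_map eE) -(place_map hE) Pi_comp_place //.
rewrite (additive_ssum _ _ (Pi_actD _)).
have actE r : r \in map snd (subst (e i) (map (map e) w) (map (map h) [:: [:: tt]])) ->
    Pi_act (runit i) (place (emb e h (i := i)) r) = place e' r.
  move=> rS; apply: Pi_act_place => //.
  - exact: emb_inj.
  - move=> [[x xi]|[]] /=; rewrite /e' ?eqxx //; by rewrite (negPf xi).
  - exact: subst_expr_on rS.
rewrite (eq_in_ssum actE) subst_letter -?map_flatten ?map_f ?map_inj_uniq //.
rewrite -(place_map e'I); congr place; rewrite -map_comp; apply: eq_map => b /=.
by rewrite -map_comp; apply: eq_map => x.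
Qed.

Lemma Pi_comp1x (J : nefin) (y : Pi J) :
  Pi_act (lunit J) (Pi_comp (tt : pt) (gen [:: [:: tt]]) y) = y.
Proof.
move: y; apply: Pi_morph_ext => // [y y'|v vE]; first by rewrite Pi_compDr Pi_actD.
pose e (x : pt) : pt + J := inl x; pose h (y : J) : pt + J := inr y.
have eE : injective e by exact: inl_inj.
have hE : injective h by exact: inr_inj.
have Ew := expr_on_map e is_expr_pt; have Ev := expr_on_map h vE.
rewrite -(place_map eE) -(place_map hE) Pi_comp_place //.
rewrite (additive_ssum _ _ (Pi_actD _)).
have actE r : r \in map snd (subst (e tt) (map (map e) [:: [:: tt]]) (map (map h) v)) ->
    Pi_act (lunit J) (place (emb e h (i := tt)) r) = place h r.
  move=> rS; apply: Pi_act_place => //.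
  - exact: emb_inj.
  - by move=> [[[] //]|].
  - exact: subst_expr_on rS.
rewrite (eq_in_ssum actE) subst_unit //; case: (v) vE => // /is_exprP[_ _ H].
by have := H (nf_point J).
Qed.

End Equivariance.

Section Associativity.
Variables I J K : nefin.

(* All the sets in the associativity axioms embed in I + J + K. *)
Let e (x : I) : I + J + K := inl (inl x).
Let g (y : J) : I + J + K := inl (inr y).
Let h (z : K) : I + J + K := inr z.

Let eI : injective e. Proof. by move=> x y []. Qed.
Let gI : injective g. Proof. by move=> x y []. Qed.
Let hI : injective h. Proof. by move=> x y []. Qed.
Let eg x y : e x != g y. Proof. by []. Qed.
Let eh x y : e x != h y. Proof. by []. Qed.
Let gh x y : g x != h y. Proof. by []. Qed.

Lemma Pi_comp_seq (i : I) (j : J) (x : Pi I) (y : Pi J) (z : Pi K) :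
  Pi_comp (inr j : ins i J) (Pi_comp i x y) z
  = Pi_act (assoc K i j) (Pi_comp i x (Pi_comp j y z)).
Proof.
move: x; apply: Pi_morph_ext => [x x'|x x'|w wE]; try by rewrite ?Pi_compDl ?Pi_actD ?Pi_compDl.
move: y; apply: Pi_morph_ext => [y y'|y y'|v vE].
- by rewrite Pi_compDr Pi_compDl.
- by rewrite Pi_compDl Pi_compDr Pi_actD.
move: z; apply: Pi_morph_ext => [z z'|z z'|u uE]; try by rewrite ?Pi_compDr ?Pi_compDr ?Pi_actD.
have Ew := expr_on_map e wE; have Ev := expr_on_map g vE; have Eu := expr_on_map h uE.
rewrite -(place_map eI) -(place_map gI) -(place_map hI).
set W := map _ w in Ew *; set M := map _ v in Ev *; set N := map _ u in Eu *.
pose E1 := emb e g (i := i); pose E2 := emb g h (i := j).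
have E1I : injective E1 by apply: emb_inj.
have E2I : injective E2 by apply: emb_inj.
have E1h s t : E1 s != h t by case: s.
have eE2 s t : e s != E2 t by case: t.
rewrite (Pi_comp_place _ eI gI eg Ew Ev) (Pi_comp_place _ gI hI gh Ev Eu) -/E1 -/E2.
rewrite (additive_ssum _ _ (@Pi_compDl _ (inr j : ins i J) K (place h N))).
rewrite (additive_ssum _ _ (@Pi_compDr _ i _ (place e W))) (additive_ssum _ _ (Pi_actD _)).
pose E12 := emb E1 h (i := inr j); pose E21 := emb e E2 (i := i).
have L r : r \in map snd (subst (e i) W M) ->
    Pi_comp (inr j : ins i J) (place E1 r) (place h N) = ssum (subst (g j) r N) (place E12).
  by move=> rS; apply: Pi_comp_place => //; apply: subst_expr_on rS.
have R r : r \in map snd (subst (g j) M N) ->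
    Pi_act (assoc K i j) (Pi_comp i (place e W) (place E2 r)) = ssum (subst (e i) W r) (place E12).
  move=> rS; have Er := subst_expr_on gI hI gh Ev Eu rS.
  rewrite (Pi_comp_place _ eI E2I eE2 Ew Er) (additive_ssum _ _ (Pi_actD _)).
  apply: eq_in_ssum => q qS; apply: Pi_act_place.
  - exact: emb_inj.
  - exact: emb_inj.
  - by move=> [s|[s|s]].
  - exact: subst_expr_on qS.
rewrite (eq_in_ssum L) (eq_in_ssum R); apply: subst_subst.
by rewrite /W -map_flatten; apply/mapP => -[].
Qed.

Lemma Pi_comp_par (i k : I) (ki : k != i) (ik : i != k) (m n : int)
    (x : Pi I) (y : Pi J) (z : Pi K) :
  Pi_gr m y -> Pi_gr n z ->
  Pi_act (par J K ki ik) (Pi_comp (del_k J ki) (Pi_comp i x y) z)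
  = Pi_comp (del_i K ik) (Pi_comp k x z) y *~ ((-1) ^ (m * n)).
Proof.
rewrite sgEz; set s := odd _ => ym zn.
move: x; apply: Pi_morph_ext => [x x'|x x'|w wE].
- by rewrite !Pi_compDl Pi_actD.
- by rewrite !Pi_compDl sgD.
rewrite {}/s; move: y ym; apply: Pi_gr_ind => [|v vE <-].
  apply: zsubgroup_eq => y y'; first by rewrite Pi_compDr Pi_compDl Pi_actD.
  by rewrite Pi_compDr sgD.
move: z zn; apply: Pi_gr_ind => [|u uE <-].
  apply: zsubgroup_eq => z z'; first by rewrite Pi_compDr Pi_actD.
  by rewrite Pi_compDr Pi_compDl sgD.
have Ew := expr_on_map e wE; have Ev := expr_on_map g vE; have Eu := expr_on_map h uE.
rewrite -(place_map eI) -(place_map gI) -(place_map hI).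
set W := map _ w in Ew *; set M := map _ v in Ev *; set N := map _ u in Eu *.
have -> : odd `|(dims v)%:Z * (dims u)%:Z| = wpar M && wpar N.
  rewrite -PoszM absz_nat oddM -(dims_map g v) -(dims_map h u).
  by rewrite (odd_dims (expr_on_nil Ev)) (odd_dims (expr_on_nil Eu)).
pose E1 := emb e g (i := i); pose E2 := emb e h (i := k).
have E1I : injective E1 by apply: emb_inj.
have E2I : injective E2 by apply: emb_inj.
have E1h s t : E1 s != h t by case: s.
have E2g s t : E2 s != g t by case: s.
rewrite (Pi_comp_place _ eI gI eg Ew Ev) (Pi_comp_place _ eI hI eh Ew Eu) -/E1 -/E2.
rewrite (additive_ssum _ _ (@Pi_compDl _ (del_k J ki) K (place h N))).
rewrite (additive_ssum _ _ (@Pi_compDl _ (del_i K ik) J (place g M))).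
rewrite (additive_ssum _ _ (Pi_actD _)).
pose E12 := emb E1 h (i := del_k J ki); pose E21 := emb E2 g (i := del_i K ik).
have L r : r \in map snd (subst (e i) W M) ->
    Pi_act (par J K ki ik) (Pi_comp (del_k J ki) (place E1 r) (place h N))
    = ssum (subst (e k) r N) (place E21).
  move=> rS; have Er := subst_expr_on eI gI eg Ew Ev rS.
  rewrite (Pi_comp_place _ E1I hI E1h Er Eu) (additive_ssum _ _ (Pi_actD _)).
  apply: eq_in_ssum => q qS; apply: Pi_act_place.
  - exact: emb_inj.
  - exact: emb_inj.
  - by move=> [[[s|s] sP]|s].
  - exact: subst_expr_on qS.
have R r : r \in map snd (subst (e k) W N) ->
    Pi_comp (del_i K ik) (place E2 r) (place g M) = ssum (subst (e i) r M) (place E21).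
  by move=> rS; apply: Pi_comp_place => //; apply: subst_expr_on rS.
rewrite (eq_in_ssum L) (eq_in_ssum R); apply: subst_par.
- by rewrite (inj_eq eI).
- by rewrite /M -map_flatten; apply/mapP => -[].
- by rewrite /N -map_flatten; apply/mapP => -[].
Qed.
End Associativity.

(*CUT*)

(** * The formulas for the structure maps *)

Lemma d_formulaE (I : finType) (V : zmodType) (w : seq (seq I)) (phi : seq (seq I) -> V) :
  [::] \notin w ->
  \sum_(1 <= j < size w) phi (merge_at w j) *~ ((-1) ^+ dims (take j w)) = ssum (der w) phi.
Proof.
elim: w phi => [|b s IHs] phi; first by rewrite big_geq ?ssum_nil.
rewrite inE negb_or eq_sym => /andP[bN sN]; rewrite der_cons ssum_merge_head.
case: s IHs sN => [|c s] IHs sN.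
  by rewrite big_geq // add0r ssum_nil sg0.
rewrite big_ltn // big_add1 /= sgD -(IHs _ sN); congr (_ + _).
  rewrite /merge_at /= drop0 /dims big_seq1 sgE odd_dim //.
rewrite (big_morph _ (sgD (bpar b)) (sg0 V _)); apply: eq_big_nat => -[|j] // _.
by rewrite /merge_at /= !dims_cons !sgE sg_sg oddD odd_dim // oddD.
Qed.

Fixpoint bitseqs (n : nat) : seq bitseq :=
  if n is n'.+1 then map (cons true) (bitseqs n') ++ map (cons false) (bitseqs n') else [:: [::]].

Lemma mem_bitseqs n c : (c \in bitseqs n) = (size c == n).
Proof.
have memE b b' (L : seq bitseq) (d : bitseq) :
    (b :: d \in map (cons b') L) = (b == b') && (d \in L).
  by elim: L => [|d' L IHL]; rewrite ?andbF //= !inE IHL eqseq_cons -andb_orr.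
have mem0 b (L : seq bitseq) : [::] \in map (cons b) L = false by elim: L.
elim: n c => [|n IHn] [|b c] //=; rewrite mem_cat ?mem0 // !memE IHn eqSS.
by case: b; rewrite ?orbF.
Qed.

Lemma uniq_bitseqs n : uniq (bitseqs n).
Proof.
elim: n => //= n IHn; have cI b : injective (@cons bool b) by move=> x y [].
rewrite cat_uniq !map_inj_uniq // IHn andbT; apply/hasPn => _ /mapP[c _ ->].
by apply/mapP => -[].
Qed.

Lemma sum_tuples (V : zmodType) n (P : pred bitseq) (F : bitseq -> V) :
  \sum_(c : n.-tuple bool | P c) F c = \sum_(c <- bitseqs n | P c) F c.
Proof.
transitivity (\sum_(c <- map val (enum {: n.-tuple bool}) | P c) F c).
  by rewrite big_map big_enum_cond.
apply: perm_big; apply: uniq_perm.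
- by rewrite map_inj_uniq ?enum_uniq //; apply: val_inj.
- exact: uniq_bitseqs.
move=> c; rewrite mem_bitseqs; apply/mapP/eqP => [[d _ ->]|cn]; first exact: size_tuple.
by move/eqP: cn => cn; exists (Tuple cn); rewrite ?mem_enum.
Qed.

(** The sum over all c is split according to the first term of c. When s or t is
    empty, there is only one sequence c with the required number of terms. *)
Lemma shuf_formulaE (T : eqType) (V : zmodType) n (s t : seq (seq T)) (phi : seq (seq T) -> V) :
  n = (size s + size t)%N -> [::] \notin s -> [::] \notin t ->
  \sum_(c : n.-tuple bool | count id c == size s)
    phi (weave c s t) *~ ((-1) ^+ koszul c s t) = ssum (shuf s t) phi.
Proof.
move=> -> {n} sN tN.
rewrite (sum_tuples _ (fun c => count id c == size s)
  (fun c => phi (weave c s t) *~ ((-1) ^+ koszul c s t))).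
elim: s t phi sN tN => [|b s IHs] t phi sN tN.
  rewrite shuf0s; elim: t phi tN => [|c t IHt] phi.
    by rewrite big_cons big_nil /= addr0.
  rewrite inE negb_or => /andP[cN tN]; rewrite /= big_cat !big_map /=.
  rewrite big_pred0 ?add0r => [|d]; last by rewrite add1n.
  by rewrite -(IHt (fun r => phi (c :: r))) //; apply: eq_bigr => d _; rewrite /dims big_nil muln0.
have [bN sN'] : [::] != b /\ [::] \notin s by move: (sN); rewrite inE negb_or => /andP.
elim: t phi tN => [|c t IHt] phi tN.
  rewrite shufs0 addn0 /= big_cat !big_map /= [X in _ + X]big1_seq ?addr0 => [|d]; last first.
    rewrite mem_bitseqs add0n => /andP[/eqP dc /eqP ds].
    by have := count_size id d; rewrite dc ds ltnn.
  have := IHs [::] (fun r => phi (b :: r)) sN' isT; rewrite shufs0 addn0 => <-.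
  by apply: eq_bigl => d; rewrite add1n eqSS.
have [cN tN'] : [::] != c /\ [::] \notin t by move: (tN); rewrite inE negb_or => /andP.
rewrite shuf_cons -(IHs (c :: t) (fun r => phi (b :: r))) // -(IHt (fun r => phi (c :: r))) //.
rewrite [(size (b :: s) + _)%N]/= addSn [bitseqs _.+1]/= big_cat !big_map; congr (_ + _).
rewrite (big_morph _ (sgD _) (sg0 V _)) -addSnnS; apply: eq_bigr => d _.
by rewrite [koszul _ _ _]/= !sgE sg_sg oddD oddM odd_dims // odd_dim // eq_sym.
Qed.

(** The letter i is at the end of its block, so that the sign of the substitution
    is reduced to m1 moving across B, as in the shuffle (false :: c). *)
Lemma Pi_comp_formula (I : nefin) (i : I) (J : nefin) (A : seq (seq {x : I | x != i}))
    (u : seq {x : I | x != i}) (B : seq (seq {x : I | x != i})) (m1 : seq J) (ms : seq (seq J)) :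
  is_expr (comp_left A u B) -> is_expr (m1 :: ms) ->
  Pi_comp i (gen (comp_left A u B)) (gen (m1 :: ms)) = comp_formula A u B m1 ms.
Proof.
move=> wE mE; rewrite Pi_comp_gen //.
have := is_expr_nil wE; rewrite mem_cat inE !negb_or !nil_map => /and3P[_ _ BN].
have := is_expr_nil mE; rewrite inE negb_or => /andP[m1N msN].
set E := emb (@inl I J) (@inr I J) (i := i).
have EI : injective E by apply: emb_inj => //; [exact: inl_inj | exact: inr_inj].
pose inI := map (map (@inl {x : I | x != i} J)); pose inJ := map (map (@inr {x : I | x != i} J)).
have EinI (C : seq (seq {x : I | x != i})) :
    map (map (@inl I J)) (map (map val) C) = map (map E) (inI C).
  by rewrite -!map_comp; apply: eq_map => b; rewrite /= -!map_comp.
have EinJ (C : seq (seq J)) : map (map (@inr I J)) C = map (map E) (inJ C).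
  by rewrite -!map_comp; apply: eq_map => b; rewrite /= -!map_comp.
have inotin (b : seq {x : I | x != i}) : (inl i : I + J) \notin map inl (map val b).
  by apply/mapP => -[y /mapP[z _ ->] [iz]]; have := valP z; rewrite /= -iz eqxx.
have skipA (phi : seq (seq (I + J)) -> Pi (ins i J)) w m :
    ssum (subst (inl i) (map (map inl) (map (map val) A) ++ w) m) phi
    = \ssum_(r <- subst (inl i) w m) phi (map (map E) (inI A) ++ r).
  rewrite EinI; elim: (A) phi => [|b A' IHA] phi //=.
  rewrite -[if _ then _ else _]/(subst _ (_ :: _) _) subst_skip ?IHA //; have := inotin b; congr (~~ (_ \in _)).
  by rewrite -!map_comp.
have hereE : map (map (@inl I J)) (rcons (map val u) i :: map (map val) B)
    = (map inl (map val u) ++ [:: inl i]) :: map (map inl) (map (map val) B).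
  by rewrite /= map_rcons cats1.
rewrite /comp_words /comp_left map_cat skipA hereE [map _ (m1 :: ms)]/=.
rewrite subst_here //= cats0 EinI EinJ shuf_map wpar_map.
transitivity (sg (bpar m1 && wpar (inI B))
   (\ssum_(r <- shuf (inI B) (inJ ms)) gen (inI A ++ (map inl u ++ map inr m1) :: r))).
  rewrite /bpar size_map; congr (sg _ _); apply: eq_ssum => r.
  by rewrite -(place_map EI) map_cat /= map_cat -!map_comp.
have := @shuf_formulaE _ _ (size B + size ms)%N (inI B) (inJ ms)
  (fun r => gen (inI A ++ (map inl u ++ map inr m1) :: r) : Pi (ins i J)).
rewrite !size_map !nil_map => <- //.
rewrite (big_morph _ (sgD _) (sg0 _ _)); apply: eq_bigr => c _.
rewrite [koszul _ _ _]/= !sgE sg_sg oddD oddM odd_dims ?nil_map // odd_dim; last first.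
  by rewrite -size_eq0 size_map size_eq0 eq_sym.
by rewrite /bpar size_map.
Qed.

Theorem proposition1 :
  exists d : forall I : nefin, Pi I -> Pi I,
    (forall (I : nefin) (w : seq (seq I)), is_expr w -> d I (gen w) = d_formula w) /\
    exists O : dg_operad (fun I : nefin => CxData (@Pi_gr I) (d I)),
      [/\ forall (I J : nefin) (f : bij I J) (w : seq (seq I)),
            is_expr w -> op_act O f (gen w) = gen (map (map f) w),
          op_one O = gen [:: [:: tt]]
        & forall (I : nefin) (i : I) (J : nefin) (A : seq (seq {x : I | x != i}))
              (u : seq {x : I | x != i}) (B : seq (seq {x : I | x != i}))
              (m1 : seq J) (ms : seq (seq J)),
            is_expr (comp_left A u B) -> is_expr (m1 :: ms) ->
            op_comp O i (gen (comp_left A u B)) (gen (m1 :: ms))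
            = comp_formula A u B m1 ms].
Proof.
exists Pi_d; split=> [I w wE|].
  by rewrite Pi_d_gen // /d_formula d_formulaE // is_expr_nil.
have one_gr : Pi_gr 0 (gen [:: [:: tt]] : Pi pt).
  by have := Pi_gr_gen is_expr_pt; rewrite /dims big_seq1.
have one_d : Pi_d (gen [:: [:: tt]] : Pi pt) = 0.
  by rewrite Pi_d_gen ?is_expr_pt //= ssum_nil.
exists (@DgOperad (fun I : nefin => CxData (@Pi_gr I) (@Pi_d I))
  Pi_act (gen [:: [:: tt]]) Pi_comp Pi_complex Pi_act_chain Pi_act_ext Pi_act_id
  Pi_act_comp (fun I i J => @Pi_comp_tensor I J i) Pi_comp_act one_gr one_d Pi_compx1 Pi_comp1x
  Pi_comp_seq Pi_comp_par).
split=> //=.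
- by move=> I J f w wE; rewrite Pi_act_gen.
- by move=> I i J A u B m1 ms; apply: Pi_comp_formula.
Qed.
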